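(* Let $G$ be a finite simple graph of tree-width $3$. Then the total chromatic number satisfies $\chi''(G)\le \Delta(G)+2$, where $\Delta(G)$ is the maximum degree of $G$.
   Context: A total colouring of $G$ assigns colours to all vertices and edges of $G$ such that adjacent vertices receive different colours, edges sharing an endpoint receive different colours, and no edge receives the same colour as either of its endpoints. $\chi''(G)$ is the minimum number of colours in a total colouring of $G$. *)

(* Defs.v *)
From mathcomp Require Import all_boot.
Set Implicit Arguments. Unset Strict Implicit. Unset Printing Implicit Defensive.

Definition simple_graph (T : finType) (e : rel T) : Prop :=
  symmetric e /\ irreflexive e.

Definition degree (T : finType) (e : rel T) (v : T) : nat := #|[set w | e v w]|.
Definition max_degree (T : finType) (e : rel T) : nat := \max_(v : T) degree e v.

(* Total colouring with colours in 'I_k: vertex colouring cv, edge colouring ce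
   (ce u v is the colour of the edge uv, required symmetric on edges). *)
Definition total_colouring (T : finType) (e : rel T) (k : nat)
  (cv : T -> 'I_k) (ce : T -> T -> 'I_k) : Prop :=
  [/\ forall u v, e u v -> ce u v = ce v u,
      forall u v, e u v -> cv u != cv v,
      forall u v w, e u v -> e u w -> v != w -> ce u v != ce u w
    & forall u v, e u v -> (ce u v != cv u) && (ce u v != cv v)].

Definition total_colourable (T : finType) (e : rel T) (k : nat) : Prop :=
  exists (cv : T -> 'I_k) (ce : T -> T -> 'I_k), @total_colouring T e k cv ce.

Definition acyclic (I : finType) (f : rel I) : Prop :=
  forall c : seq I, uniq c -> 3 <= size c -> ~~ cycle f c.

Definition is_tree (I : finType) (f : rel I) : Prop :=
  [/\ simple_graph f, 0 < #|I|, (forall i j, connect f i j) & acyclic f].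

Definition tree_decomposition (T : finType) (e : rel T)
  (I : finType) (f : rel I) (B : I -> {set T}) : Prop :=
  [/\ is_tree f,
      (forall v : T, exists i, v \in B i),
      (forall u v : T, e u v -> exists i, (u \in B i) && (v \in B i))
    & (forall v : T, forall i j, v \in B i -> v \in B j ->
         connect [rel x y | [&& f x y, v \in B x & v \in B y]] i j)].

Definition treewidth_le (T : finType) (e : rel T) (k : nat) : Prop :=
  exists (I : finType) (f : rel I) (B : I -> {set T}),
    tree_decomposition e f B /\ (forall i, #|B i| <= k.+1).

Definition has_treewidth (T : finType) (e : rel T) (k : nat) : Prop :=
  treewidth_le e k /\ forall j, j < k -> ~ treewidth_le e j.

(* Main.v *)
Require Import Defs.
From mathcomp Require Import all_boot.
From mathcomp Require Import zify.
Set Implicit Arguments. Unset Strict Implicit. Unset Printing Implicit Defensive.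

(** Let D be the maximum degree. The relation "to share a bag" of a tree decomposition is a chordal
    supergraph h of e, with a linear order in which the later h-neighbours of each vertex form a
    clique of at most 3 vertices. Keep h and D fixed and use induction on the number of edges of
    e, so that edges of h may be added to e as long as fewer edges than before are present.
    Vertices of degree 1, and of degree 2 if D >= 3, are reducible, and D <= 2 is easy.
    Otherwise consider a maximal h-independent set of h-simplicial vertices and the first vertex w
    outside it. The neighbours of w are at most 3 vertices that form a clique A of h, and a nonempty
    set S of vertices of degree 3 adjacent to w and two vertices of A. Delete the edges at some
    of these vertices, colour the rest, and extend the colouring. If D >= 5 and S has two members,
    they have a common neighbour in A; after two edge colours are fixed, a 4-cycle with lists of
    size 2 is left in the line graph, and the two vertices of S come last. If D is 3 or 4, the
    colours at the boundary of the cluster leave finitely many cases up to a permutation of the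
    colours; they are checked by computation. The few boundary colourings that do not extend are
    avoided by adding an edge between two vertices of A, by recolouring one boundary vertex, or by
    starting from a colouring in which w is already coloured. *)

(** * Extending a partial total colouring *)

(** The colour of a vertex [v] sits on the diagonal as [c v v], so one function carries the whole
    colouring. *)
Definition tcol (T : finType) (C : eqType) (e : rel T) (c : T -> T -> C) : Prop :=
  [/\ forall u v, e u v -> c u v = c v u,
      forall u v, e u v -> c u u != c v v,
      forall u v w, e u v -> e u w -> v != w -> c u v != c u w
    & forall u v, e u v -> c u v != c u u].

Lemma total_colourable_of_tcol (T : finType) (e : rel T) (K : nat) (c : T -> T -> 'I_K) :
  symmetric e -> tcol e c -> total_colourable e K.
Proof.
move=> se [c1 c2 c3 c4]; exists (fun u => c u u), c; split=> // u v euv.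
by rewrite c4 //= (c1 _ _ euv) c4 // se.
Qed.

Lemma tcol_relabel (T : finType) (C C' : eqType) (e : rel T) (c : T -> T -> C) (f : C -> C') :
  injective f -> tcol e c -> tcol e (fun u v => f (c u v)).
Proof.
move=> fI [c1 c2 c3 c4]; split=> [u v /c1-> // | u v /c2 | u v w e1 e2 /(c3 _ _ _ e1 e2) | u v /c4];
  by rewrite (inj_eq fI).
Qed.

Section Extension.
Variables (T : finType) (C : eqType) (e e' : rel T) (F : {set T}).
Variables (c0 g : T -> T -> C).
Hypotheses (se : symmetric e) (c0P : tcol e' c0).
Hypothesis ee' : forall u v, u \notin F -> v \notin F -> e u v -> e' u v.
Hypothesis gS : forall f x, f \in F -> e f x -> g f x = g x f.
Hypothesis gF : forall f x y, f \in F -> e f x -> e f y -> x != y -> g f x != g f y.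
Hypothesis gV : forall f x, f \in F -> e f x -> g f x != g f f.
Hypothesis gFF : forall f x, f \in F -> x \in F -> e f x -> g f f != g x x.
Hypothesis gX : forall f x, f \in F -> x \notin F -> e f x ->
  (g f f != c0 x x) && (g f x != c0 x x).
Hypothesis gE : forall f x y, f \in F -> x \notin F -> y \notin F -> e f x -> e x y ->
  g f x != c0 x y.
Hypothesis gXX : forall f f' x, f \in F -> f' \in F -> x \notin F -> e f x -> e f' x ->
  f != f' -> g f x != g f' x.

(** Vertices of [F] and edges that meet [F] take their colours from [g]; everything else keeps its
    colour under [c0]. Each hypothesis on [g] excludes one kind of conflict, and old elements cannot
    conflict because [e] lies in [e'] outside [F]. *)
Lemma extend_tcol :
  tcol e (fun u v => if (u \in F) || (v \in F) then g u v else c0 u v).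
Proof.
have gS' x f : f \in F -> e x f -> g x f = g f x by rewrite se => fF /(gS fF).
have [c1 c2 c3 c4] := c0P; split=> [u v euv | u v euv | u v w euv euw vw | u v euv].
- rewrite orbC; case: (boolP (v \in F)) => vF /=; first exact: gS'.
  by case: ifPn => [uF|uF]; [exact: gS | exact/c1/ee'].
- rewrite !orbb; case: ifPn => uF; case: ifPn => vF.
  + exact: gFF.
  + by have /andP[] := gX uF vF euv.
  + by rewrite eq_sym; rewrite se in euv; have /andP[] := gX vF uF euv.
  + exact/c2/ee'.
- case: (boolP (u \in F)) => uF /=; first exact: gF.
  have evu : e v u by rewrite se.
  have ewu : e w u by rewrite se.
  case: ifPn => vF; case: ifPn => wF.
  + by rewrite (gS' _ _ vF euv) (gS' _ _ wF euw); exact: gXX.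
  + by rewrite (gS' _ _ vF euv); exact: gE.
  + by rewrite eq_sym (gS' _ _ wF euw); exact: gE.
  + by apply: c3 vw; exact: ee'.
- rewrite orbb; case: (boolP (u \in F)) => uF /=; first exact: gV.
  case: ifPn => vF; last exact/c4/ee'.
  by rewrite (gS' _ _ vF euv); rewrite se in euv; have /andP[] := gX vF uF euv.
Qed.
End Extension.

(** The vertices of [F] stay as isolated vertices, so the vertex type is the same throughout the
    induction. *)
Definition del (T : finType) (e : rel T) (F : {set T}) : rel T :=
  [rel u v | [&& e u v, u \notin F & v \notin F]].

(** The colours that [c] forbids for a new edge from [x] into [F]. *)
Definition used (T C : finType) (e : rel T) (F : {set T}) (c : T -> T -> C) (x : T) : {set C} :=
  c x x |: [set c x y | y in [set y | e x y & y \notin F]].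

Lemma card_used (T C : finType) (e : rel T) (F : {set T}) (c : T -> T -> C) (x : T) :
  #|used e F c x| <= (#|[set y | e x y & y \notin F]|).+1.
Proof.
rewrite /used cardsU1 -add1n leq_add ?leq_b1 //; exact: leq_imset_card.
Qed.

(** The edges from [x] to [S] count in the degree but use no colour; the extra 1 is the colour of
    [x] itself. *)
Lemma used_degree (T C : finType) (e : rel T) (F S : {set T}) (c : T -> T -> C) (x : T) :
  S \subset F -> {in S, forall s, e x s} ->
  #|used e F c x| + #|S| <= (degree e x).+1.
Proof.
move=> sSF eS; have := card_used e F c x; rewrite /degree.
suff: #|[set y | e x y & y \notin F]| + #|S| <= #|[set w | e x w]| by lia.
rewrite -cardsUI (_ : _ :&: _ = set0) ?cards0 ?addn0.
  apply/subset_leq_card/subsetP=> y; rewrite !inE => /orP[/andP[]//|]; exact: eS.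
apply/setP=> y; rewrite !inE; apply/negbTE/negP=> /andP[/andP[_ /negP yF]] yS.
by apply: yF; exact: (subsetP sSF).
Qed.

Lemma pick_notin (C : finType) (A : {set C}) (s : seq C) :
  size s < #|A| -> exists2 x, x \in A & x \notin s.
Proof.
move=> h; have /subsetPn[x xA xs] : ~~ (A \subset s).
  by apply: contraL h => /subset_leq_card h; rewrite -leqNgt (leq_trans h) // card_size.
by exists x.
Qed.

(** Only the edges at [F] need a careful choice: a vertex of [F] of degree [d] sees at most [2d]
    colours on its edges and neighbours, and no two vertices of [F] are adjacent, so these vertices
    can be coloured last. *)
Lemma extend_independent (T C : finType) (e e' : rel T) (F : {set T})
    (c0 f : T -> T -> C) :
  symmetric e -> tcol e' c0 ->
  (forall u v, u \notin F -> v \notin F -> e u v -> e' u v) ->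
  {in F &, forall u v, ~~ e u v} ->
  {in F, forall s, (degree e s).*2 < #|C|} ->
  (forall s x y, s \in F -> e s x -> e s y -> x != y -> f s x != f s y) ->
  (forall s x, s \in F -> e s x -> f s x \notin used e F c0 x) ->
  (forall s t x, s \in F -> t \in F -> e s x -> e t x -> s != t -> f s x != f t x) ->
  exists c : T -> T -> C, tcol e c.
Proof.
move=> se c0P ee' iF dF fI fU fX.
pose bad s := [set f s x | x in [set x | e s x]] :|: [set c0 x x | x in [set x | e s x]].
have badP s : s \in F -> exists k, k \notin bad s.
  move=> sF; have: #|bad s| < #|C|.
    apply: leq_ltn_trans (dF s sF); rewrite /bad.
    rewrite (leq_trans (leq_card_setU _ _)) // -addnn /degree.
    by apply: leq_add; exact: leq_imset_card.
  move=> h; have : 0 < #|~: bad s| by rewrite cardsCs setCK; lia.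
  by case/card_gt0P=> k; rewrite inE; exists k.
pose col s := if [pick k | k \notin bad s] is Some k then k else c0 s s.
have colP s : s \in F -> col s \notin bad s.
  move=> /badP[k kb]; rewrite /col; case: pickP => [//|/(_ k)]; by rewrite kb.
pose g u v := if u == v then col u else if u \in F then f u v else f v u.
exists (fun u v => if (u \in F) || (v \in F) then g u v else c0 u v).
have nF s x : s \in F -> e s x -> x \notin F.
  by move=> sF esx; apply/negP=> xF; move: (iF s x sF xF); rewrite esx.
have sx s x : s \in F -> e s x -> (s == x) = false.
  by move=> sF esx; apply/eqP=> E; move: (nF s x sF esx); rewrite -E sF.
have gfx s x : s \in F -> e s x -> g s x = f s x.
  by move=> sF esx; rewrite /g sx // sF.
have colN s x : s \in F -> e s x -> (f s x != col s) && (col s != c0 x x).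
  move=> sF esx; have := colP s sF; rewrite inE negb_or => /andP[a b].
  apply/andP; split; [move: a | move: b]; apply: contraNneq => E.
    by rewrite -E; apply: imset_f; rewrite inE.
  by rewrite E; apply/imsetP; exists x; rewrite ?inE.
apply: (@extend_tcol _ _ e e') => //.
- by move=> s x sF esx; rewrite gfx // /g eq_sym sx // (negbTE (nF s x sF esx)).
- by move=> s x y sF ex ey xy; rewrite !gfx //; exact: fI.
- move=> s x sF esx; rewrite (gfx s x) // /g eqxx; by case/andP: (colN s x sF esx).
- by move=> s x sF xF esx; rewrite (negbTE (iF s x sF xF)) in esx.
- move=> s x sF _ esx; rewrite (gfx s x) // {1}/g eqxx; case/andP: (colN s x sF esx) => _ ->.
  by apply: contraNneq (fU s x sF esx) => ->; rewrite !inE eqxx.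
- move=> s x y sF xF yF esx exy; rewrite gfx //.
  apply: contraNneq (fU s x sF esx) => ->; rewrite !inE; apply/orP; right.
  by apply: imset_f; rewrite inE exy.
- by move=> s t x sF tF _ esx etx st; rewrite !gfx //; exact: fX.
Qed.

(** * Backtracking search for an extension *)

(* Conditionals instead of [||] and [&&], so that the search stops early under call by value. *)
Fixpoint memn (k : nat) (s : seq nat) : bool :=
  if s is x :: s' then if eqn k x then true else memn k s' else false.
Fixpoint hasn (n : nat) (f : nat -> bool) : bool :=
  if n is n'.+1 then if f n' then true else hasn n' f else false.
Fixpoint alls (A : Type) (f : A -> bool) (s : seq A) : bool :=
  if s is x :: s' then if f x then alls f s' else false else true.

Lemma memnE k s : memn k s = (k \in s).
Proof. by elim: s => //= x s IH; rewrite in_cons -eqnE IH; case: eqn. Qed.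

Lemma hasnP n f : hasn n f -> exists2 k, k < n & f k.
Proof.
elim: n => // n IH /=; case: ifPn => [fn _|_ h]; first by exists n.
by have [k kn fk] := IH h; exists k => //; exact: ltnW.
Qed.

Lemma allsE (A : Type) (f : A -> bool) (s : seq A) : alls f s = all f s.
Proof. by elim: s => //= x s ->; case: (f x). Qed.

(* The labels below [nfull] stand for vertices to be coloured together with all their edges, whose
   neighbours are listed in [nbrs]; the other labels are the boundary vertices. The colours of the
   latter are given by a list [vs], and those of their edges that leave the template by [es]. *)
Record template := Template { nfull : nat; nbrs : seq (seq nat) }.

Section Template.
Variable t : template.

Definition nb i := nth [::] (nbrs t) i.
(** A pair [(i, j)] with [i < j] is an edge, a pair [(i, i)] is a vertex. The search treats the
    vertices last. *)
Definition elts : seq (nat * nat) :=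
  flatten [seq [seq (i, j) | j <- nb i & i < j] | i <- iota 0 (nfull t)]
  ++ [seq (i, i) | i <- iota 0 (nfull t)].
(** A shared label covers both two edges with a common end and an edge with its end; the last clause
    is for adjacent vertices. *)
Definition conf (x y : nat * nat) : bool :=
  [|| x.1 == y.1, x.1 == y.2, x.2 == y.1, x.2 == y.2 |
   [&& x.1 == x.2, y.1 == y.2 & (y.1 \in nb x.1) || (x.1 \in nb y.1)]].
Definition ext_of (s : seq nat) := [seq j - nfull t | j <- s & nfull t <= j].
(** Boundary vertices are renumbered from 0. [vsts] lists those whose own colour restricts [x],
    [ests] those whose outer edges do; an edge can meet the boundary only in its larger label. *)
Definition vsts (x : nat * nat) := ext_of (if x.1 == x.2 then nb x.1 else [:: x.2]).
Definition ests (x : nat * nat) := if x.1 == x.2 then [::] else ext_of [:: x.2].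

(** Conflicts with earlier elements are computed once, as a mask over the stack of colours chosen so
    far. *)
Fixpoint compile (els prev : seq (nat * nat)) : seq (seq bool * (seq nat * seq nat)) :=
  if els is x :: els' then
    ([seq conf x y | y <- prev], (vsts x, ests x)) :: compile els' (x :: prev)
  else [::].
Definition prog := compile elts [::].

Variables (K : nat) (vs : seq nat) (es : seq (seq nat)).

Definition stat x := [seq nth 0 vs j | j <- vsts x] ++ flatten [seq nth [::] es j | j <- ests x].

Fixpoint run (p : seq (seq bool * (seq nat * seq nat))) (stack : seq nat) : bool :=
  if p is (m, (jv, je)) :: p' then
    let forb := ([seq nth 0 vs j | j <- jv] ++ flatten [seq nth [::] es j | j <- je])
                  ++ mask m stack in
    hasn K (fun k => if memn k forb then false else run p' (k :: stack))
  else true.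

Lemma conf_sym x y : conf x y = conf y x.
Proof.
rewrite /conf (eq_sym y.1 x.1) (eq_sym y.1 x.2) (eq_sym y.2 x.1) (eq_sym y.2 x.2).
rewrite (orbC (x.1 \in _)) andbCA.
by case: (x.1 == y.1); case: (x.1 == y.2); case: (x.2 == y.1); case: (x.2 == y.2).
Qed.

(** Invariant of the search: the stack holds the colours under [f0] of the elements of [prev], the
    latest first. *)
Lemma run_sound els prev (f0 : nat * nat -> nat) :
  uniq (els ++ prev) -> run (compile els prev) [seq f0 x | x <- prev] ->
  exists f : nat * nat -> nat, {in prev, f =1 f0} /\
    {in els, forall x, [/\ f x < K, f x \notin stat x &
       forall y, y \in els ++ prev -> x != y -> conf x y -> f x != f y]}.
Proof.
elim: els prev f0 => [|x els IH] prev f0; first by exists f0.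
rewrite [compile _ _]/= [run _ _]/= -/(stat x) => U /hasnP[k kK].
rewrite memnE; case: ifPn => // kforb R.
pose f1 := [fun y => f0 y with x |-> k].
move: U; rewrite /= mem_cat negb_or -andbA => /and3P[xe xp U].
have E1 : {in prev, f1 =1 f0}.
  by move=> y yp /=; case: eqP => // E; rewrite -E yp in xp.
have {}R : run (compile els (x :: prev)) [seq f1 y | y <- x :: prev].
  by rewrite /= eqxx; move: R; congr (run _ (_ :: _)); apply/esym/eq_in_map.
have [|f [fp fe]] := IH (x :: prev) f1 _ R.
  by move: U; rewrite !cat_uniq /= negb_or xe xp.
have fx : f x = k by rewrite fp ?mem_head //= eqxx.
have fprev : {in prev, f =1 f0}.
  by move=> y yp; rewrite fp ?in_cons ?yp ?orbT // E1.
exists f; split=> // y; rewrite in_cons => /orP[/eqP->|ye].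
  rewrite fx kK; move: kforb; rewrite mem_cat negb_or => /andP[ks km]; split=> // z.
  rewrite /= in_cons => /orP[/eqP->|]; first by rewrite eqxx.
  rewrite mem_cat => /orP[ze|zp] xz c.
    have [_ _ h] := fe z ze; rewrite -fx eq_sym; apply: h.
    - by rewrite mem_cat mem_head orbT.
    - by rewrite eq_sym.
    - by rewrite conf_sym.
  rewrite fprev //; apply: contraNneq km => ->.
  elim: prev zp {fe fp E1 fprev R U xp IH} => //= a p IHp.
  rewrite in_cons => /orP[/eqP<-|/IHp h]; first by rewrite c mem_head.
  by case: (conf x a); rewrite ?in_cons h ?orbT.
have [a b cc] := fe y ye; split=> // z zz; apply: cc; move: zz.
by rewrite !(mem_cat, in_cons) => /or3P[]->; rewrite ?orbT.
Qed.
End Template.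

Section Embedding.
Variables (T : finType) (e e' : rel T) (K : nat) (t : template) (x0 : T) (L : seq T).
Variables (c0 : T -> T -> 'I_K) (vs : seq nat) (es : seq (seq nat)).

Local Notation "''v_' i" := (nth x0 L i) (at level 8, i at level 2, format "''v_' i").
Local Notation nf := (nfull t).

Definition full_set := [set x in take nf L].

Definition embedded := [/\ uniq L, uniq (elts t), nf <= size L,
  forall i, i < nf -> all (gtn (size L)) (nb t i) &
  forall i, i < nf -> forall u, e 'v_i u = (u \in [seq 'v_j | j <- nb t i])].

(** The lists in [es] need only contain the colours of the outer edges. Further entries merely
    restrict the search, which permits lists of a prescribed length. *)
Definition instance_of := forall j, j < size L - nf ->
  nth 0 vs j = c0 'v_(nf + j) 'v_(nf + j) /\
  forall y, y \notin full_set -> e 'v_(nf + j) y -> (c0 'v_(nf + j) y : nat) \in nth [::] es j.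

Definition key (i j : nat) := (minn i j, maxn i j).

Lemma extend_embedded :
  symmetric e -> irreflexive e -> tcol e' c0 ->
  (forall u v, u \notin full_set -> v \notin full_set -> e u v -> e' u v) ->
  embedded -> instance_of -> run K vs es (prog t) [::] ->
  exists c : T -> T -> 'I_K, tcol e c.
Proof.
move=> se ie c0P ee' [UL UE nfL nbL nbE] inst R.
have [|f [_ fP]] := run_sound (f0 := fun=> 0) _ R; first by rewrite cats0.
rewrite cats0 in fP.
have vK i : i < size L -> index 'v_i L = i by move=> h; rewrite index_uniq.
have nbj i j : i < nf -> j \in nb t i -> j < size L.
  by move=> /nbL/allP h /h.
have enb i j : i < nf -> j \in nb t i -> e 'v_i 'v_j.
  by move=> h1 h2; rewrite nbE //; apply: map_f.
have nbe i u : i < nf -> e 'v_i u -> index u L \in nb t i /\ 'v_(index u L) = u.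
  move=> h; rewrite nbE // => /mapP[j jn ->]; by rewrite vK ?(nbj _ _ h).
have nbs i j : i < nf -> j < nf -> j \in nb t i -> i \in nb t j.
  move=> h1 h2 /(enb _ _ h1); rewrite se => /(nbe _ _ h2)[].
  by rewrite vK // (leq_trans h1).
have nbi i : i < nf -> i \notin nb t i.
  by move=> h; apply/negP=> /(enb _ _ h); rewrite ie.
have keyE i j : i < nf -> j \in nb t i -> key i j \in elts t.
  move=> h jn; rewrite /elts mem_cat; apply/orP; left; apply/flattenP.
  have [ij|ij] := ltnP i j.
    exists [seq (i, j) | j <- nb t i & i < j]; first by apply: map_f; rewrite mem_iota.
    rewrite /key (minn_idPl (ltnW ij)) (maxn_idPr (ltnW ij)).
    by apply: map_f; rewrite mem_filter ij.
  have {}ij : j < i by rewrite ltn_neqAle ij andbT; apply: contraTneq jn => ->; exact: nbi.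
  exists [seq (j, k) | k <- nb t j & j < k].
    by apply: map_f; rewrite mem_iota (ltn_trans ij).
  rewrite /key (minn_idPr (ltnW ij)) (maxn_idPl (ltnW ij)).
  by apply: map_f; rewrite mem_filter ij nbs // (ltn_trans ij).
have keyV i : i < nf -> key i i \in elts t.
  move=> h; rewrite /key minnn maxnn mem_cat; apply/orP; right.
  by apply: map_f; rewrite mem_iota.
(* The default only supplies an inhabitant of ['I_K]; on template elements the search returns values
   below [K]. *)
pose col x : 'I_K := insubd (c0 x0 x0) (f x).
have colE x : x \in elts t -> col x = f x :> nat.
  by move=> /fP[fK _ _]; rewrite val_insubd fK.
have colN x y : x \in elts t -> y \in elts t -> x != y -> conf t x y -> col x != col y.
  move=> xe ye xy c; rewrite -val_eqE /= !colE //.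
  by have [_ _ h] := fP x xe; exact: h.
have keyN i j k : j != k -> key i j != key i k.
  by move=> jk; apply/eqP => -[]; lia.
have keyC i j k : conf t (key i j) (key i k).
  rewrite /conf /key /=; case: (leqP i j) => _; case: (leqP i k) => _; by rewrite ?eqxx ?orbT.
have keyS i j : key i j = key j i by rewrite /key minnC maxnC.
pose g u v := col (key (index u L) (index v L)).
have inF u : (u \in full_set) = (index u L < nf) by rewrite inE in_take_leq.
have FE u : u \in full_set -> 'v_(index u L) = u.
  by rewrite inE => /mem_take h; rewrite nth_index.
have main u x : u \in full_set -> e u x ->
    [/\ index u L < nf, index x L \in nb t (index u L), 'v_(index x L) = x & x \in L].
  move=> uF eux; have iu := uF; rewrite inF in iu.
  have [a b] : index x L \in nb t (index u L) /\ 'v_(index x L) = x.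
    by apply: nbe => //; rewrite FE.
  split=> //; rewrite -index_mem; exact: nbj a.
exists (fun u v => if (u \in full_set) || (v \in full_set) then g u v else c0 u v).
have indN x y : x \in L -> x != y -> index x L != index y L.
  move=> xL; apply: contra => /eqP h; have yL : y \in L by rewrite -index_mem -h index_mem.
  by rewrite -(nth_index x0 xL) h nth_index.
apply: (@extend_tcol _ _ e e') => //.
- by move=> u x _ _; rewrite /g keyS.
- move=> u x y uF ex ey xy; have [a b c d] := main u x uF ex; have [_ b' _ _] := main u y uF ey.
  by apply: colN; rewrite ?keyE ?keyN ?keyC // indN.
- move=> u x uF ex; have [a b c d] := main u x uF ex.
  apply: colN (keyE _ _ a b) (keyV _ a) _ (keyC _ _ _).
  by apply: keyN; apply: contraTneq b => ->; exact: nbi.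
- move=> u x uF xF ex; have [a b c d] := main u x uF ex.
  have a' := xF; rewrite inF in a'.
  apply: colN; rewrite ?keyV //.
    apply/eqP => -[]; rewrite !minnn => E _; move: (nbi _ a); by rewrite {1}E b.
  by rewrite /conf /key !minnn !maxnn !eqxx /= b !orbT.
- move=> u x uF; rewrite inF -leqNgt => xF ex; have [a b c d] := main u x uF ex.
  have [lt1 lt2] : index u L < index x L /\ index x L - nf < size L - nf.
    by move: (nbj _ _ a b); lia.
  have [vE _] := inst _ lt2; rewrite subnKC // c in vE.
  apply/andP; split; rewrite -val_eqE /= colE ?keyV ?keyE //.
    have [_ + _] := fP _ (keyV _ a); apply: contraNneq => ->; rewrite -vE.
    rewrite /stat mem_cat; apply/orP; left; rewrite /vsts /key minnn maxnn eqxx.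
    by apply: map_f; apply: map_f; rewrite mem_filter xF.
  have [_ + _] := fP _ (keyE _ _ a b); apply: contraNneq => ->; rewrite -vE.
  rewrite /stat mem_cat; apply/orP; left.
  rewrite /vsts /key (minn_idPl (ltnW lt1)) (maxn_idPr (ltnW lt1)) ltn_eqF //=.
  by rewrite /ext_of /= xF mem_head.
- move=> u x y uF; rewrite inF -leqNgt => xF yF ex exy; have [a b c d] := main u x uF ex.
  have [lt1 lt2] : index u L < index x L /\ index x L - nf < size L - nf.
    by move: (nbj _ _ a b); lia.
  have [_] := inst _ lt2; rewrite subnKC // c => /(_ y yF exy) vE.
  rewrite -val_eqE /= colE ?keyE //.
  have [_ + _] := fP _ (keyE _ _ a b); apply: contraNneq => ->.
  rewrite /stat mem_cat; apply/orP; right.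
  rewrite /ests /key (minn_idPl (ltnW lt1)) (maxn_idPr (ltnW lt1)) ltn_eqF //=.
  by rewrite /ext_of /= xF /= cats0.
- move=> u v x uF vF _ eux evx uv; have [a b _ _] := main u x uF eux.
  have [a' b' _ _] := main v x vF evx.
  rewrite /g !(keyS _ (index x L)); apply: colN; rewrite ?keyC ?keyN //.
  + by rewrite keyS keyE.
  + by rewrite keyS keyE.
  + by rewrite indN //; move: uF; rewrite inE => /mem_take.
Qed.
End Embedding.

(** * Enumeration of the boundary colourings *)

Fixpoint combs (n : nat) (s : seq nat) : seq (seq nat) :=
  match n, s with
  | 0, _ => [:: [::]]
  | n'.+1, x :: s' => [seq x :: c | c <- combs n' s'] ++ combs n s'
  | _, _ => [::]
  end.
Fixpoint prods (A : Type) (l : seq (seq A)) : seq (seq A) :=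
  if l is s :: l' then
    let r := prods l' in flatten [seq [seq x :: c | c <- r] | x <- s]
  else [:: [::]].
(** Colours are renamed 0, 1, 2, ... in order of first appearance: a normal form under permutations
    of the colours. *)
Definition pattern (c : seq nat) := [seq index x (undup c) | x <- c].
Definition patterns K n := undup [seq pattern c | c <- prods (nseq n (iota 0 K))].
Definition edge_lists K (vs od : seq nat) : seq (seq (seq nat)) :=
  prods [seq combs x.2 (rem x.1 (iota 0 K)) | x <- zip vs od].
(* [od] bounds the number of edges that leave the template at each boundary vertex; colours matter
   only up to permutation, so [vs] ranges over patterns. *)
Definition check K (od : seq nat) (flt : seq nat -> bool)
    (tst : seq nat -> seq (seq nat) -> bool) :=
  alls (fun vs => if flt vs then alls (tst vs) (edge_lists K vs od) else true) (patterns K (size od)).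
Definition solved K t :=
  let p := prog t in fun vs es => run K vs es p [::].

Lemma mem_prods (A : eqType) (c : seq A) (l : seq (seq A)) :
  size c = size l -> (forall i x0, i < size c -> nth x0 c i \in nth [::] l i) -> c \in prods l.
Proof.
elim: l c => [|s l IH] [|x c] //= [sz] h.
apply/flattenP; exists [seq x :: c | c <- prods l]; first by apply: map_f; exact: (h 0 x).
by apply/map_f/IH => // i y ic; exact: (h i.+1 y).
Qed.

(** [P] marks entries that must be chosen, [Q] entries that may be. Going along the list, an
    optional entry is taken only when too few allowed entries would remain without it. *)
Lemma combs_between (P Q : pred nat) (l : seq nat) (n : nat) :
  {in l, forall y, P y -> Q y} -> count P l <= n <= count Q l ->
  exists s, [/\ s \in combs n l, size s = n, all Q s & {in l, forall x, P x -> x \in s}].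
Proof.
elim: l n => [|x l IH] n PQ.
  by case: n => [_|//]; exists [::].
have {}IH m := IH m (fun y yl => PQ y (@mem_behead _ (x :: l) y yl)).
case: n => [|n].
  rewrite leqn0 andbT => h; exists [::]; split=> // y yl Py.
  by move: h; rewrite -leqn0 leqNgt -has_count => /hasPn/(_ y yl); rewrite Py.
have take_x : Q x -> count P l <= n <= count Q l -> exists s, [/\ s \in combs n.+1 (x :: l),
    size s = n.+1, all Q s & {in x :: l, forall y, P y -> y \in s}].
  move=> Qx /IH[s [s1 s2 s3 s4]]; exists (x :: s); split.
  - by rewrite /= mem_cat map_f.
  - by rewrite /= s2.
  - by rewrite /= Qx.
  - by move=> y; rewrite !in_cons => /orP[->//|yl] /(s4 y yl) ->; rewrite orbT.
have skip_x : ~~ P x -> count P l <= n.+1 <= count Q l -> exists s, [/\ s \in combs n.+1 (x :: l),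
    size s = n.+1, all Q s & {in x :: l, forall y, P y -> y \in s}].
  move=> Px /IH[s [s1 s2 s3 s4]]; exists s; split=> //.
  - by rewrite /= mem_cat s1 orbT.
  - by move=> y; rewrite in_cons => /orP[/eqP->|/s4//]; rewrite (negbTE Px).
rewrite /=; case Px: (P x).
  by have Qx := PQ x (mem_head _ _) Px; rewrite Qx !add1n !ltnS; exact: take_x.
case Qx: (Q x); rewrite ?add0n ?add1n ?ltnS; last by apply: skip_x; rewrite Px.
case/andP=> h1; rewrite leq_eqVlt => /orP[/eqP nl|h2]; last by apply: skip_x; rewrite ?Px ?h1.
apply: take_x => //; rewrite nl leqnn andbT;
rewrite (@eq_in_count _ P (predI P Q)) => [|y yl /=]; first by apply: sub_count => y /andP[].
by case Py: (P y); rewrite ?(PQ y _ Py) // in_cons yl orbT.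
Qed.

(** The distinct colours of [s] in order of appearance, followed by all others, enumerate ['I_K];
    each colour is sent to its place. *)
Lemma canonical_relabel K (s : seq 'I_K) :
  exists2 f : 'I_K -> 'I_K, injective f & [seq val (f x) | x <- s] = pattern [seq val x | x <- s].
Proof.
pose u := undup s ++ [seq x <- enum 'I_K | x \notin s].
have uE x : x \in u by rewrite mem_cat mem_undup mem_filter mem_enum andbT orbN.
have Uu : uniq u.
  rewrite cat_uniq undup_uniq filter_uniq ?enum_uniq // andbT /=.
  by apply/hasPn => x; rewrite mem_filter mem_undup => /andP[].
have su : size u = K.
  by rewrite -(card_uniqP Uu) -[RHS]card_ord; apply: eq_card => x; rewrite uE.
pose f (x : 'I_K) : 'I_K := insubd x (index x u).
have fE x : f x = index x u :> nat.
  have h : index x u < K by have := uE x; rewrite -index_mem su.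
  by rewrite val_insubd h.
exists f.
  move=> x y /(congr1 val); rewrite /= !fE => h.
  by rewrite -(nth_index x (uE x)) h nth_index.
rewrite /pattern -map_comp; apply/eq_in_map => x xs; rewrite /= fE.
rewrite index_cat mem_undup xs undup_map_inj; last exact: val_inj.
by rewrite index_map //; exact: val_inj.
Qed.

Lemma seq_choice (A : Type) (a : A) (n : nat) (Q : nat -> A -> Prop) :
  (forall j, j < n -> exists s, Q j s) ->
  exists2 r : seq A, size r = n & forall j, j < n -> Q j (nth a r j).
Proof.
elim: n => [|n IH] h; first by exists [::].
have [r sr rP] := IH (fun j jn => h j (ltnW jn)); have [s sP] := h n (ltnSn n).
exists (rcons r s); rewrite ?size_rcons ?sr // => j; rewrite nth_rcons sr ltnS leq_eqVlt.
by case/orP=> [/eqP->|jn]; [rewrite ltnn eqxx | rewrite jn; exact: rP].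
Qed.

Section Check.
Variables (T : finType) (e e' : rel T) (K : nat) (t : template) (x0 : T) (L : seq T).
Variables (c0 : T -> T -> 'I_K) (od : seq nat) (z : nat -> T).
Variables (flt : seq nat -> bool) (tst : seq nat -> seq (seq nat) -> bool).
Local Notation nf := (nfull t).
Local Notation F := (full_set t L).

(** The colours are permuted until the boundary vertices show a pattern, and the colours of the
    outer edges are padded to lists of the lengths in [od]. The padding avoids the colour of the
    edge to [z j], a vertex of [F] that [e'] may already join to the boundary. *)
Lemma check_sound :
  check K od flt tst -> irreflexive e -> tcol e' c0 -> uniq L ->
  size L = nf + size od ->
  (forall u v, u \notin F -> v \notin F -> e u v -> e' u v) ->
  all (fun o => o.+1 < K) od -> (forall j, z j \in F) ->
  (forall j, j < size od -> #|[set y | e (nth x0 L (nf + j)) y & y \notin F]| <= nth 0 od j) ->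
  (forall c : T -> T -> 'I_K, tcol e' c -> flt [seq val (c x x) | x <- drop nf L]) ->
  exists (c : T -> T -> 'I_K) vs es, [/\ tcol e' c, instance_of e t x0 L c vs es, tst vs es,
    vs = [seq val (c x x) | x <- drop nf L] &
    forall j, j < size od -> size (nth [::] es j) = nth 0 od j /\
      (e' (nth x0 L (nf + j)) (z j) -> (c (nth x0 L (nf + j)) (z j) : nat) \notin nth [::] es j)].
Proof.
move=> chk ie c0P UL sL ee' odK zF deg fltP.
have [f fI fE] := canonical_relabel [seq c0 x x | x <- drop nf L].
pose c u v := f (c0 u v); have cP : tcol e' c := tcol_relabel fI c0P.
have sd : size (drop nf L) = size od by rewrite size_drop sL addKn.
pose vs := [seq val (c x x) | x <- drop nf L].
have svs : size vs = size od by rewrite size_map.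
have vsp : vs \in patterns K (size od).
  rewrite mem_undup; apply/mapP.
  exists [seq val x | x <- [seq c0 x x | x <- drop nf L]]; last by rewrite -fE -map_comp.
  apply: mem_prods; first by rewrite !size_map size_nseq.
  move=> i k; rewrite !size_map sd => ij; rewrite nth_nseq ij mem_iota /=.
  rewrite (nth_map (c0 x0 x0)) ?size_map ?sd //; exact: ltn_ord.
have vsj j : j < size od -> nth 0 vs j = c (nth x0 L (nf + j)) (nth x0 L (nf + j)).
  by move=> h; rewrite (nth_map x0) ?sd // nth_drop.
have xF j : j < size od -> nth x0 L (nf + j) \notin F.
  move=> h; rewrite inE in_take_leq ?sL ?leq_addr // index_uniq ?sL ?ltn_add2l //.
  by rewrite -leqNgt leq_addr.
have [|es ses esP] := @seq_choice _ [::] (size od) (fun j s =>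
    [/\ s \in combs (nth 0 od j) (rem (nth 0 vs j) (iota 0 K)), size s = nth 0 od j,
        e' (nth x0 L (nf + j)) (z j) -> (c (nth x0 L (nf + j)) (z j) : nat) \notin s &
        forall y, y \notin F -> e (nth x0 L (nf + j)) y ->
          (c (nth x0 L (nf + j)) y : nat) \in s]).
  move=> j jod.
  set x := nth x0 L (nf + j).
  pose U := [seq val (c x y) | y <- enum [set y | e x y & y \notin F]].
  pose Q (k : nat) := ~~ (e' x (z j) && (k == c x (z j) :> nat)).
  have Ul : uniq (rem (nth 0 vs j) (iota 0 K)) by rewrite rem_uniq ?iota_uniq.
  have UQ k : k \in U -> Q k.
    case/mapP => y; rewrite mem_enum inE => /andP[exy yF] ->.
    apply/negP => /andP[exz /eqP/val_inj E]; have [_ _ /(_ x y (z j)) h _] := cP.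
    move: h; rewrite E eqxx; case: eqP => [yz|_ /(_ (ee' _ _ (xF j jod) yF exy) exz isT)//].
    by move: yF; rewrite yz zF.
  have [||s [s1 s2 s3 s4]] := @combs_between (mem U) Q (rem (nth 0 vs j) (iota 0 K)) (nth 0 od j).
  - by move=> k _; exact: UQ.
  - apply/andP; split.
      apply: leq_trans (deg j jod); rewrite -/x cardE.
      rewrite -(size_map (fun y => val (c x y))) -/U -size_filter.
      apply: uniq_leq_size; first exact: filter_uniq.
      by move=> y; rewrite mem_filter => /andP[].
    have := count_predC Q (rem (nth 0 vs j) (iota 0 K)).
    rewrite size_rem ?size_iota; last by rewrite mem_iota /= vsj.
    have : count (predC Q) (rem (nth 0 vs j) (iota 0 K)) <= 1.
      apply: leq_trans (_ : count (pred1 (val (c x (z j)))) (rem (nth 0 vs j) (iota 0 K)) <= 1).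
        by apply: sub_count => k /=; rewrite negbK => /andP[].
      by rewrite count_uniq_mem // leq_b1.
    (* One colour is lost to the boundary vertex and at most one to its edge to [z j]; [o + 1 < K]
       leaves at least [o]. *)
    have := allP odK _ (mem_nth 0 jod); rewrite /=; lia.
  exists s; split=> //.
    move=> exz; apply/negP => /(allP s3); rewrite /Q exz eqxx //.
  move=> y yF exy; apply: s4.
    rewrite mem_rem_uniq ?iota_uniq // inE mem_iota /= ltn_ord andbT vsj //.
    by have [_ _ _ /(_ x y)] := cP; apply; apply: ee' => //; exact: xF.
  by apply/mapP; exists y => //; rewrite mem_enum inE exy.
exists c, vs, es; split=> //.
- move=> j; rewrite sL addKn => jod; rewrite vsj //; split=> // y yF exy.
  by have [_ _ _] := esP j jod; apply.
- move: chk; rewrite /check allsE => /allP/(_ _ vsp); rewrite fltP // allsE => /allP; apply.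
  apply: mem_prods; first by rewrite size_map size_zip svs ses minnn.
  move=> i k; rewrite ses => iod; rewrite (nth_map (0, 0)) ?size_zip ?svs ?minnn //.
  rewrite nth_zip //= (set_nth_default [::]) ?ses //.
  by have [] := esP i iod.
- by move=> j jod; have [] := esP j jod.
Qed.
End Check.

(** * The reducible clusters *)

(* Except in the first two templates, the labels stand for one to three elements of the set [S] of
   [configuration], its vertex [w], and elements of its clique [A], in this order. *)
Definition tmpl_path := Template 2 [:: [:: 1; 2]; [:: 0; 3]].
Definition tmpl_triangle := Template 2 [:: [:: 1; 2]; [:: 0; 2]].
Definition tmpl_leaf_one_common := Template 2 [:: [:: 1; 2; 3]; [:: 0; 2; 4]].
Definition tmpl_leaf_two_common := Template 2 [:: [:: 1; 2; 3]; [:: 0; 2; 3]].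
Definition tmpl_leaf_hub4 := Template 2 [:: [:: 1; 2; 3]; [:: 0; 2; 3; 4]].
Definition tmpl_fork := Template 2 [:: [:: 2; 3; 4]; [:: 2; 3; 5]].
Definition tmpl_twins := Template 2 [:: [:: 2; 3; 4]; [:: 2; 3; 4]].
Definition tmpl_triplets := Template 3 [:: [:: 3; 4; 5]; [:: 3; 4; 5]; [:: 3; 4; 5]].
Definition tmpl_twins_closed := Template 4 [:: [:: 2; 3; 4]; [:: 2; 3; 4]; [:: 0; 1; 3]; [:: 0; 1; 2]].
Definition tmpl_twins_open := Template 3 [:: [:: 2; 3; 4]; [:: 2; 3; 4]; [:: 0; 1; 5]].
Definition tmpl_fork_apex := Template 4 [:: [:: 2; 3; 4]; [:: 2; 3; 5]; [:: 0; 1; 3]; [:: 0; 1; 2]].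
Definition tmpl_fork_side := Template 3 [:: [:: 2; 3; 4]; [:: 2; 3; 5]; [:: 0; 1; 4]].
Definition tmpl_K33 := Template 6 [:: [:: 3; 4; 5]; [:: 3; 4; 5]; [:: 3; 4; 5];
  [:: 0; 1; 2]; [:: 0; 1; 2]; [:: 0; 1; 2]].
Definition tmpl_twins_and_third := Template 5 [:: [:: 3; 4; 5]; [:: 3; 4; 5]; [:: 3; 4; 6];
  [:: 0; 1; 2]; [:: 0; 1; 2]].
Definition tmpl_three_pairs := Template 4 [:: [:: 3; 4; 5]; [:: 3; 4; 6]; [:: 3; 5; 6]; [:: 0; 1; 2]].

(* The instances that cannot be extended have to be excluded otherwise: in [recol] every recolouring
   of the [i]-th boundary vertex helps; in [recol2] at least two colours of boundary vertex 0 that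
   differ from the colour of boundary vertex 1 help; in [solved_or_no_hub] the colouring does not
   even extend to the vertex with label 1. *)
Definition recol K t i := let p := prog t in fun vs es =>
  if run K vs es p [::] then true else
  alls (fun k => if memn k (nth 0 vs i :: nth [::] es i) then true
                 else run K (set_nth 0 vs i k) es p [::]) (iota 0 K).
Definition recol2 K t := let p := prog t in fun vs es =>
  if run K vs es p [::] then true else
  2 <= count (fun k => if memn k (nth 0 vs 0 :: nth 0 vs 1 :: nth [::] es 0) then false
                 else run K (set_nth 0 vs 0 k) es p [::]) (iota 0 K).
(** [q] lists the colours of the three edges from the hub to the boundary, then the colour of the
    hub. *)
Definition hub_ext (vs : seq nat) (es : seq (seq nat)) (q : seq nat) : bool :=
  [&& uniq q, nth 0 q 3 \notin vs &
      alls (fun j => nth 0 q j \notin nth 0 vs j :: nth [::] es j) (iota 0 3)].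
Definition solved_or_no_hub K t := let p := prog t in fun vs es =>
  if run K vs es p [::] then true else
  alls (fun q => ~~ hub_ext vs es q) (prods (nseq 4 (iota 0 K))).

(** In this and the following checks there are [D + 2] colours, and each bound is [D] minus the
    number of template edges at that boundary vertex. *)
Lemma check_path : check 4 [:: 1; 1] xpredT (solved 4 tmpl_path).
Proof. by vm_compute. Qed.

Lemma check_triangle : check 4 [:: 0] xpredT (solved 4 tmpl_triangle).
Proof. by vm_compute. Qed.

Lemma check_leaf_one_common_5 : check 5 [:: 1; 2; 2] xpredT (solved 5 tmpl_leaf_one_common).
Proof. by vm_compute. Qed.

Lemma check_leaf_one_common_6 : check 6 [:: 2; 3; 3] xpredT (solved 6 tmpl_leaf_one_common).
Proof. by vm_compute. Qed.

Lemma check_leaf_two_common_5 : check 5 [:: 1; 1] xpredT (solved 5 tmpl_leaf_two_common).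
Proof. by vm_compute. Qed.

Lemma check_leaf_two_common_6 : check 6 [:: 2; 2] xpredT (solved 6 tmpl_leaf_two_common).
Proof. by vm_compute. Qed.

Lemma check_leaf_hub4 : check 6 [:: 2; 2; 3] xpredT (solved_or_no_hub 6 tmpl_leaf_hub4).
Proof. by vm_compute. Qed.

Lemma check_fork : check 6 [:: 2; 2; 3; 3] (fun vs => nth 0 vs 2 != nth 0 vs 3) (recol 6 tmpl_fork 0).
Proof. by vm_compute. Qed.

Lemma check_twins : check 6 [:: 2; 2; 2] xpredT (recol2 6 tmpl_twins).
Proof. by vm_compute. Qed.

Lemma check_triplets : check 6 [:: 1; 1; 1] xpredT (solved 6 tmpl_triplets).
Proof. by vm_compute. Qed.

Lemma check_twins_closed : check 5 [:: 1] xpredT (solved 5 tmpl_twins_closed).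
Proof. by vm_compute. Qed.

Lemma check_twins_open : check 5 [:: 1; 1; 2] xpredT (recol 5 tmpl_twins_open 0).
Proof. by vm_compute. Qed.

Lemma check_fork_apex : check 5 [:: 2; 2] xpredT (solved 5 tmpl_fork_apex).
Proof. by vm_compute. Qed.

Lemma check_fork_side : check 5 [:: 1; 1; 2] xpredT (solved 5 tmpl_fork_side).
Proof. by vm_compute. Qed.

Lemma check_K33 : check 5 [::] xpredT (solved 5 tmpl_K33).
Proof. by vm_compute. Qed.

Lemma check_twins_and_third : check 5 [:: 1; 2] xpredT (solved 5 tmpl_twins_and_third).
Proof. by vm_compute. Qed.

Lemma check_three_pairs : check 5 [:: 1; 1; 1] xpredT (solved 5 tmpl_three_pairs).
Proof. by vm_compute. Qed.

(** * Elimination orders from tree decompositions *)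

Definition within (I : finType) (f : rel I) (X : {pred I}) : rel I :=
  [rel x y | [&& f x y, x \in X & y \in X]].

Lemma connect_exit (I : finType) (f : rel I) (X : {pred I}) (a b : I) :
  connect f a b -> a \in X -> b \notin X -> exists x y, [/\ x \in X, y \notin X & f x y].
Proof.
case/connectP=> p; elim: p a => [|c p IH] a /= => [_ ->|]; first by move=> ->.
case/andP=> fac pc eb aX bX; have [cX|cX] := boolP (c \in X); first exact: (IH c).
by exists a, c.
Qed.

Lemma path_within (I : finType) (f : rel I) (X : {pred I}) (a : I) (p : seq I) :
  path (within f X) a p -> path f a p && all (mem X) p.
Proof.
elim: p a => //= c p IH a /andP[/and3P[fac _ cX]] /IH/andP[-> h].
by rewrite fac h /= andbT.
Qed.

(** The list has the newest node at its head; each node has at most one neighbour among the older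
    ones, its parent. *)
Fixpoint grown (I : finType) (f : rel I) (s : seq I) : Prop :=
  if s is x :: s' then {in s' &, forall j k, f x j -> f x k -> j = k} /\ grown f s' else True.

Lemma grown_unique (I : finType) (f : rel I) (s : seq I) (i j k : I) :
  grown f s -> j \in s -> k \in s -> index i s < index j s -> index i s < index k s ->
  f i j -> f i k -> j = k.
Proof.
elim: s => //= x s IH [gx gs].
rewrite !in_cons [x == i]eq_sym [x == j]eq_sym [x == k]eq_sym.
case: (j =P x) => //= _; case: (k =P x) => [->|_] //= js ks; case: (i =P x) => [->|_].
  by move=> _ _; exact: gx.
by rewrite !ltnS; exact: IH.
Qed.

(** The tree is grown node by node as a connected set; [p] is the order of insertion, so the smaller
    neighbour of a node is its parent. *)
Lemma tree_order (I : finType) (f : rel I) :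
  is_tree f -> exists2 p : I -> nat, injective p &
    forall i j k, f i j -> f i k -> p j < p i -> p k < p i -> j = k.
Proof.
case=> -[fs fi] I0 fc fa.
have grow n : n < #|I| -> exists s : seq I, [/\ uniq s, size s = n.+1,
    {in s &, forall a b, connect (within f (mem s)) a b} & grown f s].
  elim: n => [|n IH] nI.
    case/card_gt0P: I0 => i _; exists [:: i]; split=> // a b.
    by rewrite !inE => /eqP-> /eqP->.
  have [s [us ss cs gs]] := IH (ltnW nI).
  have [z zs] : exists z, z \notin s.
    apply/existsP; rewrite -[[exists _, _]]negbK negb_exists; apply/negP => /forallP h.
    move: nI; rewrite -ss ltnNge => /negP; apply; rewrite -(card_uniqP us).
    by apply/subset_leq_card/subsetP => x _; rewrite -[x \in s]negbK.
  have [y0 y0s] : exists y0, y0 \in s by case: (s) ss => // a l _; exists a; rewrite mem_head.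
  have [y [x [ys xs fyx]]] := connect_exit (X := mem s) (fc y0 z) y0s zs.
  have sub a b : connect (within f (mem s)) a b -> connect (within f (mem (x :: s))) a b.
    apply: connect_sub => c d /and3P[fcd cs' ds']; apply: connect1.
    by rewrite /within /= fcd !inE in cs' ds' *; rewrite cs' ds' !orbT.
  have symw : connect_sym (within f (mem (x :: s))).
    by apply: sym_connect_sym => a b; rewrite /within /= fs [(a \in _) && _]andbC.
  have cyx : connect (within f (mem (x :: s))) y x.
    by apply: connect1; rewrite /within /= fyx !inE eqxx (ys : y \in s) orbT.
  exists (x :: s); split; rewrite /= ?ss ?xs //.
    have toy a : a \in x :: s -> connect (within f (mem (x :: s))) a y.
      by rewrite in_cons => /orP[/eqP->|as_]; [rewrite symw | apply/sub/cs].
    by move=> a b /toy h /toy; rewrite symw; exact: connect_trans.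
  split=> // j k js ks fxj fxk; apply/eqP/negPn/negP => jk.
  (* Two neighbours of [x] in the connected set [s] are joined by a simple path in [s], which [x]
     would close to a cycle. *)
  have /connectP[p0 pp0 ek] := cs j k js ks.
  move: ek; case/shortenP: pp0 => p pp up _ ek.
  have /andP[fp ps] := path_within pp.
  have uxp : uniq (x :: j :: p).
    rewrite cons_uniq up andbT in_cons negb_or; apply/andP; split.
      by apply: contraNneq xs => ->.
    by apply/negP => /(allP ps) h; rewrite (h : x \in s) in xs.
  have szp : 3 <= size (x :: j :: p) by case: (p) ek jk => [/= ->|//]; rewrite eqxx.
  by move: (fa _ uxp szp); rewrite /= fxj rcons_path fp -ek fs fxk.
have [|s [us ss _ gs]] := grow #|I|.-1; first by rewrite prednK.
have {}ss : size s = #|I| by rewrite ss prednK.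
have sI x : x \in s.
  apply/negPn/negP => xs; have : uniq (x :: s) by rewrite /= xs.
  by move=> /card_uniqP E; have := max_card [in x :: s]; rewrite E /= ss ltnn.
(* The newest node has index 0, so the index is reversed. *)
exists (fun i => size s - index i s).
  move=> i j /= h; have hi := sI i; have hj := sI j; rewrite -!index_mem in hi hj.
  have E : index i s = index j s by rewrite -(subKn (ltnW hi)) h subKn // ltnW.
  by rewrite -(nth_index i (sI i)) E nth_index.
move=> i j k fij fik hj hk.
by apply: (grown_unique gs (sI j) (sI k) _ _ fij fik); lia.
Qed.

Section Order.
Variables (I : finType) (f : rel I) (p : I -> nat).
Hypotheses (fs : symmetric f) (pI : injective p).
Hypothesis pU : forall i j k, f i j -> f i k -> p j < p i -> p k < p i -> j = k.

Lemma down_neighbour (X : {set I}) (m x : I) :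
  {in X &, forall i j, connect (within f (mem X)) i j} ->
  m \in X -> {in X, forall y, p m <= p y} -> x \in X -> x != m ->
  exists y, [/\ y \in X, f x y & p y < p x].
Proof.
move=> cX mX mmin xX xm.
have [/existsP[y /and3P[a b c]]|no] := boolP [exists y, [&& y \in X, f x y & p y < p x]].
  by exists y.
have {}no y : y \in X -> f x y -> p y < p x -> false.
  by move=> a b c; case/existsP: no; exists y; rewrite a b c.
(* all vertices reachable from [x] inside [X] are reached by ascending paths, hence lie above [x] *)
pose up := [rel a b | within f (mem X) a b && (p a < p b)].
have asc y : connect up x y -> p x <= p y.
  case/connectP=> q; elim: q x {xX xm no} => [x _ ->//|z q IH] a /= /andP[/andP[_ az]] pq ey.
  exact: leq_trans (ltnW az) (IH z pq ey).
have clos y z : connect up x y -> within f (mem X) y z -> connect up x z.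
  move=> xy /and3P[fyz yX zX].
  (* If [p z < p y], then [z] is the predecessor of [y] on an ascending path from [x], as [y] has
     only one smaller neighbour; [y = x] is excluded by [no]. *)
  case: (ltngtP (p y) (p z)) => [lt|gt|/pI <-//].
    by apply: connect_trans xy _; apply: connect1; rewrite /up /within /= fyz lt yX zX.
  case/connectP: (xy) => q; elim/last_ind: q => [_ /= E|q w _].
    by move: (no z zX); rewrite -E => /(_ fyz gt).
  rewrite rcons_path last_rcons => /andP[pq /andP[/and3P[f1 _ _] lt]] E; subst w.
  rewrite (@pU y z (last x q)) // 1?fs //.
  by apply/connectP; exists q.
have /connectP[q + em] := cX x m xX mX.
suff H a : connect up x a -> path (within f (mem X)) a q -> connect up x (last a q).
  move=> pq; have := H x (connect0 _ _) pq; rewrite -em => /asc h.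
  by case/eqP: xm; apply/pI/eqP; rewrite eqn_leq h mmin.
by elim: q a {em} => //= b q IH a xa /andP[ab]; apply: IH; exact: clos ab.
Qed.
End Order.

(** Let [top v] be the bag of [v] nearest the root. Vertices with deeper top bags come first, and
    then all later [h]-neighbours of [v] lie in the bag at [top v], which yields both the bound and
    the clique. *)
Lemma elimination_order (T : finType) (e : rel T) (k : nat) :
  irreflexive e -> treewidth_le e k ->
  exists (h : rel T) (r : T -> nat), [/\ symmetric h, irreflexive h, subrel e h, injective r &
    forall v, #|[set u | h v u & r v < r u]| <= k /\
      {in [set u | h v u & r v < r u] &, forall x y, x != y -> h x y}].
Proof.
move=> ie [I [f [B [[ft vB eB cB] szB]]]].
have [p pI pU] := tree_order ft; have [[fs _] _ _ _] := ft.
pose X v := [set i | v \in B i].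
have ex v : exists i, v \in B i := vB v.
pose top v := [arg min_(i < xchoose (ex v) | v \in B i) p i].
have topP v : v \in B (top v) /\ forall i, v \in B i -> p (top v) <= p i.
  by rewrite /top; case: arg_minnP => [|i vi mi]; [exact: (xchooseP (ex v)) | split].
have down v x : v \in B x -> x != top v -> exists y, [/\ v \in B y, f x y & p y < p x].
  move=> vx xm; have [tv mv] := topP v.
  have [||||y [yX fxy lt]] := @down_neighbour I f p fs pI pU (X v) (top v) x _ _ _ _ xm.
  - move=> i j; rewrite !inE => vi vj; have := cB v i j vi vj.
    by apply: connect_sub => a b h; apply: connect1; rewrite /within /= !inE.
  - by rewrite inE.
  - by move=> y; rewrite inE; exact: mv.
  - by rewrite inE.
  - by exists y; rewrite inE in yX.
(* From a common bag of [u] and [v] one walks towards the root: until [top v] is reached, the parent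
   bag contains both vertices. *)
have key u v j : p (top u) <= p (top v) -> u \in B j -> v \in B j -> u \in B (top v).
  move=> le; have [n] := ubnP (p j); elim: n j => // n IH j; rewrite ltnS => jn uj vj.
  have [<-//|jv] := eqVneq j (top v).
  have [y [vy fjy lt]] := down v j vj jv.
  have ju : j != top u.
    apply: contraTneq lt => ->; rewrite -leqNgt (leq_trans le) //; exact: (topP v).2.
  have [y' [uy' fjy' lt']] := down u j uj ju.
  have E := pU _ _ _ fjy fjy' lt lt'; subst y'.
  by apply: (IH y) => //; exact: leq_trans lt jn.
pose N := \max_i p i; pose M := #|T|.
(* A lexicographic order: decreasing in [p (top v)], with ties broken by [enum_rank v < M]. *)
pose r v := (N - p (top v)) * M + enum_rank v.
have rk v : enum_rank v < M := ltn_ord _.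
have pN i : p i <= N by exact: leq_bigmax.
have rlt u v : p (top v) < p (top u) -> r u < r v.
  move=> h; have := pN (top u); have := pN (top v); have := rk u => a b c.
  have : (N - p (top u)).+1 * M <= (N - p (top v)) * M by rewrite leq_mul2r; apply/orP; right; lia.
  rewrite mulSn /r; lia.
pose h := [rel u v | (u != v) && [exists i, (u \in B i) && (v \in B i)]].
exists h, r; split.
- by move=> u v; rewrite /h /= eq_sym; congr (_ && _); apply: eq_existsb => i; rewrite andbC.
- by move=> u; rewrite /h /= eqxx.
- move=> u v euv; rewrite /h /=; apply/andP; split.
    by apply: contraTneq euv => ->; rewrite ie.
  by have [i] := eB u v euv => hi; apply/existsP; exists i.
- move=> u v E; case: (ltngtP (p (top u)) (p (top v))) => [/rlt|/rlt|E'].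
  + by rewrite E ltnn.
  + by rewrite E ltnn.
  + by move: E; rewrite /r E' => /addnI/val_inj/enum_rank_inj.
- move=> v.
  have sub : [set u | h v u & r v < r u] \subset B (top v) :\ v.
    apply/subsetP => u; rewrite !inE /= => /andP[/andP[vu /existsP[i /andP[vi ui]]] lt].
    rewrite eq_sym vu; apply: (key _ _ i) => //.
    by rewrite leqNgt; apply/negP => /rlt; rewrite ltnNge ltnW.
  split.
    have [tv _] := topP v.
    apply: leq_trans (subset_leq_card sub) _.
    by have := szB (top v); rewrite (cardsD1 v) tv.
  move=> x y /(subsetP sub) + /(subsetP sub); rewrite !inE => /andP[_ a] /andP[_ b] xy.
  by rewrite /h /= xy; apply/existsP; exists (top v); rewrite a b.
Qed.

(** * The unavoidable configuration *)

Definition nbhd (T : finType) (e : rel T) (v : T) : {set T} := [set w | e v w].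

(** Only the set [V] of non-isolated vertices matters. A simplicial vertex has at most three
    [h]-neighbours in [V] and degree at least 3, so its neighbourhoods in [h] (within [V]) and in
    [e] coincide. The edge [u0 v0] shows that an [h]-independent set cannot exhaust [V]. *)
Lemma configuration (T : finType) (h e : rel T) (r : T -> nat) (u0 v0 : T) :
  symmetric h -> irreflexive h -> symmetric e -> subrel e h -> injective r ->
  (forall v, #|[set u | h v u & r v < r u]| <= 3 /\
      {in [set u | h v u & r v < r u] &, forall x y, x != y -> h x y}) ->
  e u0 v0 -> (forall v, 0 < degree e v -> 3 <= degree e v) ->
  exists (w : T) (A S : {set T}), [/\ #|A| <= 3 /\ {in A &, forall x y, x != y -> h x y},
    w \notin A /\ S != set0, nbhd e w \subset A :|: S, 3 <= degree e w &
    forall s, s \in S -> exists x y, [/\ x \in A, y \in A, x != y, s \notin A &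
      nbhd e s = [set w; x; y]]].
Proof.
move=> hs hi es eh rI peo e0 deg3.
pose V := [set v | 0 < degree e v].
have eV u v : e u v -> (u \in V) && (v \in V).
  move=> euv; rewrite !inE; apply/andP; split; apply/card_gt0P.
    by exists v; rewrite inE.
  by exists u; rewrite inE es.
pose N v := [set u in V | h v u].
have inN v u : (u \in N v) = (u \in V) && h v u by rewrite in_set.
pose simp s := [&& s \in V, #|N s| <= 3 &
  [forall x in N s, forall y in N s, (x != y) ==> h x y]].
pose good (X : {set T}) := [forall x in X, simp x] && [forall x in X, forall y in X, ~~ h x y].
have good0 : good set0.
  by apply/andP; split; apply/forallP => x; rewrite inE.
(* [S0] is a largest [h]-independent set of simplicial vertices, [w] the first vertex outside it *)
case: (arg_maxnP (fun X : {set T} => #|X|) good0) => S0 /andP[/forall_inP simpS indS] maxS.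
have ind x y : x \in S0 -> y \in S0 -> ~~ h x y.
  by move=> xS yS; have /forall_inP/(_ x xS)/forall_inP/(_ y yS) := indS.
have simpP s : simp s -> [/\ s \in V, nbhd e s = N s, #|N s| = 3 &
    {in N s &, forall x y, x != y -> h x y}].
  case/and3P => sV c3 cl.
  have sub : nbhd e s \subset N s.
    by apply/subsetP => u; rewrite inE => esu; rewrite inN eh // andbT; case/andP: (eV _ _ esu).
  have d3 : 3 <= #|nbhd e s| by apply: deg3; rewrite inE in sV.
  have E : nbhd e s = N s by apply/eqP; rewrite eqEcard sub (leq_trans c3).
  split=> //; first by apply/eqP; rewrite eqn_leq c3 -E d3.
  by move=> x y xN yN; have /forall_inP/(_ x xN)/forall_inP/(_ y yN)/implyP := cl.
have [w1 w1V] : exists w1, w1 \in V :\: S0.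
  case/andP: (eV _ _ e0) => uV vV.
  have [uS|uS] := boolP (u0 \in S0); last by exists u0; rewrite inE uS.
  exists v0; rewrite inE vV andbT; apply/negP => vS.
  by move: (ind _ _ uS vS); rewrite eh.
case: (arg_minnP r w1V) => w wVS wmin.
have /andP[wS wV] : (w \notin S0) && (w \in V) by move: (wVS : w \in V :\: S0); rewrite inE.
pose A := N w :\: S0; pose S := N w :&: S0.
have subA : A \subset [set u | h w u & r w < r u].
  apply/subsetP => a; rewrite in_setD inN => /and3P[aS aV hwa].
  rewrite in_set hwa /= ltn_neqAle; apply/andP; split.
    by apply: contraTneq hwa => /rI ->; rewrite hi.
  by apply: wmin; rewrite -[X in is_true X]/(a \in V :\: S0) in_setD aS.
have [cU qU] := peo w.
have cliA : {in A &, forall x y, x != y -> h x y}.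
  by move=> x y /(subsetP subA) xA /(subsetP subA); exact: qU.
exists w, A, S; split.
- by split=> //; exact: leq_trans (subset_leq_card subA) cU.
- split; first by rewrite in_setD inN hi !andbF.
  apply/eqP => Se.
  (* If [S] were empty, [w] would be simplicial and [h]-independent of [S0], so it could be added to
     [S0]. *)
  have NA : N w = A by rewrite /A -[LHS](setID _ S0) -/S Se set0U.
  have simpw : simp w.
    apply/and3P; split; rewrite ?NA //; first exact: leq_trans (subset_leq_card subA) cU.
    by apply/forall_inP => x xA; apply/forall_inP => y yA; apply/implyP; exact: cliA.
  have hwS x : x \in S0 -> ~~ h w x.
    move=> xS; apply/negP => hwx.
    have : x \in S by rewrite in_setI inN xS hwx !andbT; case/simpS/simpP: xS.
    by rewrite Se inE.
  have : good (w |: S0).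
    apply/andP; split; apply/forall_inP => x.
      by rewrite in_setU1 => /orP[/eqP->//|]; exact: simpS.
    rewrite in_setU1 => /orP[/eqP->|xS]; apply/forall_inP => y; rewrite in_setU1 => /orP[/eqP->|yS].
    - by rewrite hi.
    - exact: hwS.
    - by rewrite hs hwS.
    - exact: ind.
  by move/maxS; rewrite /= cardsU1 wS add1n ltnn.
- apply/subsetP => u; rewrite inE => ewu; rewrite setUC setID inN eh // andbT.
  by case/andP: (eV _ _ ewu).
- by apply: deg3; rewrite inE in wV.
- move=> s; rewrite in_setI inN => /andP[/andP[sV hws] sS].
  have [_ NE c3 cl] := simpP s (simpS s sS).
  have wN : w \in N s by rewrite inN wV hs.
  have c2 : #|N s :\ w| == 2 by move: c3; rewrite (cardsD1 w) wN add1n => -[->].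
  have /cards2P[x [y [xy E]]] := c2.
  (* The [h]-neighbours of [s] in [V] form a clique with [w] in it, and none of them is in the
     independent set [S0]. *)
  have inA z : z \in N s :\ w -> z \in A.
    rewrite in_setD1 => /andP[zw zN]; have := zN; rewrite inN => /andP[zV hsz].
    rewrite in_setD inN zV (cl w z) // 1?eq_sym // !andbT.
    by apply/negP => zS; move: (ind _ _ sS zS); rewrite hsz.
  exists x, y; split=> //.
  + by apply: inA; rewrite E !inE eqxx.
  + by apply: inA; rewrite E !inE eqxx orbT.
  + by rewrite in_setD sS.
  + by rewrite NE -(setD1K wN) E setUA.
Qed.

(** * Reductions *)

(** The numerical side conditions as one boolean, which computation decides for a concrete template.
    The last clause says that [od] bounds the degree left over at each boundary vertex. *)
Definition fits (D : nat) (t : template) (n : nat) (od : seq nat) : bool :=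
  [&& uniq (elts t), n == nfull t + size od, 0 < nfull t, 0 < size (nb t 0),
      all (fun i => all (gtn n) (nb t i)) (iota 0 (nfull t)), all (fun o => o.+1 < D + 2) od &
      all (fun j => D <= nth 0 od j + count (fun i => nfull t + j \in nb t i) (iota 0 (nfull t)))
        (iota 0 (size od))].

Lemma pick_nat (s : seq nat) (n : nat) : size s < n -> exists2 k, k < n & k \notin s.
Proof.
move=> sn; have /allPn[k] : ~~ all (mem s) (iota 0 n).
  apply: contraL sn => /allP sub; rewrite -leqNgt -[n](size_iota 0).
  exact: uniq_leq_size (iota_uniq _ _) sub.
by rewrite mem_iota => kn ks; exists k.
Qed.

Section Reduce.
Variables (T : finType) (e e' : rel T) (D : nat).
Hypotheses (se : symmetric e) (ie : irreflexive e) (degD : forall v, degree e v <= D).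
Variables (t : template) (x0 : T) (L : seq T) (od : seq nat).
Local Notation K := (D + 2).
Local Notation nf := (nfull t).
Local Notation F := (full_set t L).
Local Notation "''v_' i" := (nth x0 L i) (at level 8, i at level 2, format "''v_' i").
Hypotheses (fit : fits D t (size L) od) (UL : uniq L).
Hypothesis nbE : forall i, i < nf -> forall u, e 'v_i u = (u \in [seq 'v_j | j <- nb t i]).
Hypothesis ee' : forall u v, u \notin F -> v \notin F -> e u v -> e' u v.

Lemma fits_embedded : embedded e t x0 L.
Proof.
case/and5P: fit => Ue /eqP sL _ _ /and3P[nbL _ _]; split=> //; first by rewrite sL leq_addr.
by move=> i ti; apply: (allP nbL); rewrite mem_iota.
Qed.

Lemma outer_degree j : j < size od -> #|[set y | e 'v_(nf + j) y & y \notin F]| <= nth 0 od j.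
Proof.
move=> jo; have [_ _ nfL nbL _] := fits_embedded.
case/and5P: fit => _ /eqP sL _ _ /and3P[_ _ /allP/(_ j)]; rewrite mem_iota => /(_ jo) dj.
pose l := [seq 'v_i | i <- iota 0 nf & nf + j \in nb t i].
have lU : uniq l.
  rewrite map_inj_in_uniq ?filter_uniq ?iota_uniq // => a b.
  rewrite !mem_filter !mem_iota /= => /andP[_ a1] /andP[_ b1] /eqP.
  by rewrite nth_uniq ?(leq_trans a1) ?(leq_trans b1) // => /eqP.
have lP x : x \in l -> x \in F /\ e 'v_(nf + j) x.
  case/mapP => i; rewrite mem_filter mem_iota /= => /andP[ji ti] ->; split.
    by rewrite inE in_take_leq // index_uniq // (leq_trans ti).
  by rewrite se nbE //; apply: map_f.
have : #|[set y | e 'v_(nf + j) y & y \notin F]| + #|[set x in l]| <= D.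
  apply: leq_trans (degD 'v_(nf + j)); rewrite /degree -cardsUI (_ : _ :&: _ = set0).
    rewrite cards0 addn0; apply/subset_leq_card/subsetP => y; rewrite !in_set.
    by case/orP=> [/andP[]//|/lP[]].
  apply/setP => y; rewrite !in_set; apply/negbTE/negP => /andP[/andP[_ yF]] /lP[yF' _].
  by move: yF'; rewrite inE (negbTE yF).
have -> : #|[set x in l]| = count (fun i => nf + j \in nb t i) (iota 0 nf).
  by rewrite cardsE (card_uniqP lU) size_map size_filter.
move: dj; lia.
Qed.

Lemma checked (c0 : T -> T -> 'I_K) flt tst (z : nat -> T) :
  check K od flt tst -> tcol e' c0 -> (forall j, z j \in F) ->
  (forall c : T -> T -> 'I_K, tcol e' c -> flt [seq val (c x x) | x <- drop nf L]) ->
  exists (c : T -> T -> 'I_K) vs es, [/\ tcol e' c, instance_of e t x0 L c vs es, tst vs es,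
    vs = [seq val (c x x) | x <- drop nf L] &
    forall j, j < size od -> size (nth [::] es j) = nth 0 od j /\
      (e' 'v_(nf + j) (z j) -> (c 'v_(nf + j) (z j) : nat) \notin nth [::] es j)].
Proof.
move=> chk c0P zF; case/and5P: (fit) => _ /eqP sL _ _ /and3P[_ odK _].
by apply: (check_sound (e := e) chk) c0P _ _ _ _ zF _ => //; exact: outer_degree.
Qed.

(** The argument [j] gives this the shape required of a constant [z] in [checked]. *)
Lemma v0F (j : nat) : 'v_0 \in F.
Proof.
case/and5P: fit => _ /eqP sL nf0 _ _; have sL0 : 0 < size L by rewrite sL; lia.
by rewrite inE in_take_leq ?sL ?leq_addr // index_uniq.
Qed.

Lemma reduce_solved (c0 : T -> T -> 'I_K) flt : check K od flt (solved K t) -> tcol e' c0 ->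
  (forall c : T -> T -> 'I_K, tcol e' c -> flt [seq val (c x x) | x <- drop nf L]) ->
  exists c : T -> T -> 'I_K, tcol e c.
Proof.
move=> chk c0P fltP; have [c [vs [es [cP inst R _ _]]]] := checked chk c0P v0F fltP.
exact: (extend_embedded se ie cP ee' fits_embedded inst R).
Qed.

(** Changing one boundary vertex to [k] is harmless if [k] avoids its outer edges, all listed in
    [es], and its outer neighbours; its edges into [F] are coloured anew anyway. *)
Lemma recolour_run (c : T -> T -> 'I_K) vs es j (k : nat) :
  tcol e' c -> instance_of e t x0 L c vs es -> j < size od -> k < K ->
  k \notin nth [::] es j -> (forall y, y \notin F -> e 'v_(nf + j) y -> k != c y y) ->
  run K (set_nth 0 vs j k) es (prog t) [::] -> exists c : T -> T -> 'I_K, tcol e c.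
Proof.
move=> [c1 c2 c3 c4] inst jod kK kes kN R.
case/and5P: (fit) => _ /eqP sL _ _ _.
have xF i : i < size od -> 'v_(nf + i) \notin F.
  move=> h; rewrite inE in_take_leq ?sL ?leq_addr // index_uniq ?sL ?ltn_add2l //.
  by rewrite -leqNgt leq_addr.
have vI i : i < size od -> ('v_(nf + i) == 'v_(nf + j)) = (i == j).
  by move=> h; rewrite nth_uniq ?sL ?ltn_add2l // eqn_add2l.
set x := 'v_(nf + j) in kN vI.
pose d u v := if (u == x) && (v == x) then Ordinal kK else c u v.
have dE u v : e u v -> d u v = c u v.
  move=> euv; rewrite /d; case: (u =P x) => //= ux; case: (v =P x) => // vx.
  by move: euv; rewrite ux vx ie.
have instj y : y \notin F -> e x y -> (c x y : nat) \in nth [::] es j.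
  by move=> yF exy; have [|_] := inst j _; [rewrite sL addKn | apply].
(* The new colour need not respect the edges of [e'] beyond [del e F], for instance an added
   edge. *)
have dP : tcol (del e F) d.
  split=> [u v | u v | u v w | u v].
  - by case/and3P=> euv uF vF; rewrite !dE // 1?se // c1 // ee'.
  - case/and3P=> euv uF vF; rewrite /d !andbb.
    case: (u =P x) => [ux|_]; case: (v =P x) => [vx|_].
    + by move: euv; rewrite ux vx ie.
    + by rewrite -val_eqE /= kN // -ux.
    + by rewrite eq_sym -val_eqE /= kN // -vx se.
    + by rewrite c2 // ee'.
  - by case/and3P=> euv uF vF /and3P[euw _ wF] vw; rewrite !dE // c3 // ee'.
  - case/and3P=> euv uF vF; rewrite dE // /d andbb; case: (u =P x) => [ux|_].
      rewrite -val_eqE /=; apply: contraNneq kes => <-; rewrite ux instj // -ux //.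
    by rewrite c4 // ee'.
apply: (extend_embedded se ie dP _ fits_embedded _ R).
  by move=> u v uF vF euv; rewrite /del /= euv uF.
move=> i; rewrite sL addKn => iod; have [|vE esE] := inst i _; first by rewrite sL addKn.
split.
  rewrite nth_set_nth /= /d andbb vI //; case: eqP => // _; exact: vE.
by move=> y yF exy; rewrite dE //; exact: esE.
Qed.

(** The new colour avoids the old one, the outer edges and the outer neighbours: at most
    [2 * od_j + 1] colours. *)
Lemma reduce_recol (c0 : T -> T -> 'I_K) flt j : check K od flt (recol K t j) -> tcol e' c0 ->
  (forall c : T -> T -> 'I_K, tcol e' c -> flt [seq val (c x x) | x <- drop nf L]) ->
  j < size od -> (nth 0 od j).*2.+1 < K ->
  exists c : T -> T -> 'I_K, tcol e c.
Proof.
move=> chk c0P fltP jod small.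
have [c [vs [es [cP inst R _ esP]]]] := checked chk c0P v0F fltP.
move: R; rewrite /recol; case: ifP => [R _|_ ].
  exact: (extend_embedded se ie cP ee' fits_embedded inst R).
rewrite allsE => /allP alt.
pose N := [set y | e 'v_(nf + j) y & y \notin F].
pose bad := nth 0 vs j :: nth [::] es j ++ [seq val (c y y) | y <- enum N].
have sb : size bad < K.
  rewrite /= size_cat size_map -cardE; have [-> _] := esP j jod; have := outer_degree jod.
  by rewrite -/N; lia.
have [k kK kb] := pick_nat sb.
move: kb; rewrite in_cons mem_cat !negb_or => /and3P[k1 k2 k3].
apply: (recolour_run cP inst jod kK k2) => [y yF exy|].
  by apply: contraNneq k3 => ->; apply: map_f; rewrite mem_enum inE exy.
have := alt k; rewrite mem_iota memnE in_cons (negbTE k1) (negbTE k2); exact.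
Qed.

(** The helpful colours already differ from that of boundary vertex 1. Two of them exist, so one
    also differs from that of [Y], the only other possible outer neighbour. *)
Lemma reduce_recol2 (c0 : T -> T -> 'I_K) (Y : T) :
  check K od xpredT (recol2 K t) -> tcol e' c0 -> 1 < size od ->
  (forall y, y \notin F -> e 'v_(nf + 0) y -> y = 'v_(nf + 1) \/ y = Y) ->
  exists c : T -> T -> 'I_K, tcol e c.
Proof.
move=> chk c0P od1 wN.
have [|c [vs [es [cP inst R _ esP]]]] := checked chk c0P v0F; first by [].
case/and5P: (fit) => _ /eqP sL _ _ _.
move: R; rewrite /recol2; case: ifP => [R _|_].
  exact: (extend_embedded se ie cP ee' fits_embedded inst R).
set P := (fun k : nat => _) => cnt.
pose l := [seq k <- iota 0 K | P k].
have [k] : exists2 k, k \in l & k != c Y Y.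
  apply/hasP; rewrite has_count; have := count_predC (pred1 (val (c Y Y))) l.
  rewrite count_uniq_mem ?filter_uniq ?iota_uniq // size_filter -/P => E.
  by move: cnt; rewrite -E; case: (_ \in l); rewrite ?add0n ?add1n // => /ltnW.
rewrite mem_filter mem_iota /= andbC => /andP[kK]; rewrite /P memnE !in_cons; case: ifPn => //.
rewrite !negb_or => /and3P[k1 k2 k3] R kY.
apply: (recolour_run cP inst (ltnW od1) kK k3 _ R) => y yF /(wN y yF)[->|->] //.
by have [|<-] := inst 1 _; first by rewrite sL addKn.
Qed.

(** The given colouring already covers the hub ['v_1], so its colours there refute the alternative
    that no extension to the hub exists. *)
Lemma reduce_hub (c0 : T -> T -> 'I_K) :
  check K od xpredT (solved_or_no_hub K t) -> tcol e' c0 -> nf = 2 -> size od = 3 ->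
  symmetric e' -> (forall j, j < 3 -> e' 'v_1 'v_(nf + j)) ->
  exists c : T -> T -> 'I_K, tcol e c.
Proof.
move=> chk c0P nf2 od3 se' hub.
case/and5P: (fit) => _ /eqP sL _ _ _.
have zF (j : nat) : 'v_1 \in F.
  by rewrite inE in_take_leq ?sL ?leq_addr // index_uniq // ?nf2 // sL nf2.
have [|c [vs [es [cP inst R vsE esP]]]] := checked chk c0P zF; first by [].
move: R; rewrite /solved_or_no_hub; case: ifP => [R _|_].
  exact: (extend_embedded se ie cP ee' fits_embedded inst R).
rewrite allsE => /allP alt; exfalso.
have [c1 c2 c3 c4] := cP.
pose w := 'v_1; pose a := 'v_(nf + 0); pose b := 'v_(nf + 1); pose d := 'v_(nf + 2).
have ab : a != b by rewrite nth_uniq ?sL ?od3 ?nf2.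
have ad : a != d by rewrite nth_uniq ?sL ?od3 ?nf2.
have bd : b != d by rewrite nth_uniq ?sL ?od3 ?nf2.
have ea : e' w a := hub 0 isT. have eb : e' w b := hub 1 isT. have ed : e' w d := hub 2 isT.
pose q := [seq val k | k <- [:: c w a; c w b; c w d; c w w]].
have /alt/negP : q \in prods (nseq 4 (iota 0 K)).
  apply: mem_prods => // -[|[|[|[|//]]]] x _; rewrite mem_iota add0n leq0n; exact: ltn_ord.
apply; apply/and3P; split.
- rewrite map_inj_uniq; last exact: val_inj.
  by rewrite /= !inE !negb_or (c3 _ _ _ ea eb) // (c3 _ _ _ ea ed) // (c3 _ _ _ eb ed) // !c4.
- rewrite /= vsE; apply/mapP => -[x xd /val_inj E].
  have [j j3 xE] : exists2 j, j < 3 & x = 'v_(nf + j).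
    exists (index x (drop nf L)); last by rewrite -nth_drop nth_index.
    by rewrite -od3 -[size od](addKn nf) -sL -size_drop index_mem.
  by have /negP[] := c2 _ _ (hub j j3); rewrite -/w E xE.
- rewrite allsE; apply/allP => j; rewrite mem_iota /= add0n => j3.
  have jod : j < size od by rewrite od3.
  have -> : nth 0 q j = c w 'v_(nf + j) by case: j j3 {jod} => [|[|[|]]].
  rewrite in_cons negb_or; have [|-> _] := inst j _; first by rewrite sL addKn.
  have h := hub j j3; have h' : e' 'v_(nf + j) 'v_1 by rewrite se'.
  rewrite (c1 _ _ h); apply/andP; split; last exact: (esP j jod).2 h'.
  by rewrite val_eqE; exact: c4 h'.
Qed.
End Reduce.

(** * Choosing colours from lists *)

Lemma distinct_choice (T C : finType) (l : seq T) (av : T -> {set C}) (k0 : C) :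
  uniq l -> (forall x, x \in l -> index x l < #|av x|) ->
  exists f : T -> C, {in l, forall x, f x \in av x} /\ {in l &, injective f}.
Proof.
elim/last_ind: l => [|l x IH]; first by exists (fun=> k0).
rewrite rcons_uniq => /andP[xl U] h.
have [|f [fa fi]] := IH U.
  by move=> y yl; have := h y; rewrite mem_rcons in_cons yl orbT -cats1 index_cat yl; exact.
have [k kx kf] : exists2 k, k \in av x & k \notin map f l.
  apply: pick_notin; rewrite size_map; have := h x.
  by rewrite mem_rcons mem_head -cats1 index_cat (negbTE xl) /= eqxx addn0; exact.
exists (fun y => if y == x then k else f y); split.
  move=> y; rewrite mem_rcons in_cons; case: (y =P x) => [->//|_] /=; exact: fa.
have fk y : y \in l -> f y <> k by move=> yl E; case/negP: kf; rewrite -E map_f.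
move=> y z; rewrite !mem_rcons !in_cons; case: (y =P x) => [->|_] /=; case: (z =P x) => [->|_] //=.
- by move=> _ /fk E /esym.
- by move=> /fk.
- exact: fi.
Qed.

Lemma four_cycle_choice (C : finType) (P Q R S : {set C}) :
  1 < #|P| -> 1 < #|Q| -> 1 < #|R| -> 1 < #|S| ->
  exists p q r s, [/\ p \in P, q \in Q, r \in R & s \in S] /\ [/\ p != q, q != r, r != s & s != p].
Proof.
move=> hP hQ hR hS.
have [/existsP[x /andP[xP xR]]|dj] := boolP [exists x, (x \in P) && (x \in R)].
  have [q qQ] := @pick_notin _ Q [:: x] hQ; have [s sS] := @pick_notin _ S [:: x] hS.
  by rewrite !inE => sx qx; exists x, q, x, s; rewrite eq_sym qx sx eq_sym sx.
have PR x y : x \in P -> y \in R -> x != y.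
  by move=> xP yR; apply: contraNneq dj => E; apply/existsP; exists x; rewrite xP E.
(* a colour pair (p, r) is spoiled for Q only if Q = {p, r}, which happens for at most one pair,
   and likewise for S *)
have spoil (X : {set C}) p r : 1 < #|X| -> ~~ [exists q in X, (q != p) && (q != r)] ->
    p \in X /\ r \in X /\ X \subset [set p; r].
  move=> hX /exists_inPn no.
  have sub : X \subset [set p; r].
    by apply/subsetP => q /no; rewrite negb_and !negbK !inE.
  have E : X = [set p; r].
    by apply/eqP; rewrite eqEcard sub (leq_trans _ hX) // cards2; case: (p != r).
  by rewrite E !inE !eqxx orbT.
have [p1 [p2 [p1P p2P p12]]] : exists p1 p2, [/\ p1 \in P, p2 \in P & p1 != p2].
  have [p1 p1P _] := @pick_notin _ P [::] (ltnW hP).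
  by have [p2 p2P] := @pick_notin _ P [:: p1] hP; rewrite inE eq_sym; exists p1, p2.
have [r1 [r2 [r1R r2R r12]]] : exists r1 r2, [/\ r1 \in R, r2 \in R & r1 != r2].
  have [p1' p1P' _] := @pick_notin _ R [::] (ltnW hR).
  by have [p2' p2P'] := @pick_notin _ R [:: p1'] hR; rewrite inE eq_sym; exists p1', p2'.
(* Three pairs suffice, since each of [Q] and [S] spoils at most one. *)
pose ok p r := [exists q in Q, (q != p) && (q != r)] && [exists q in S, (q != p) && (q != r)].
suff [p [r [pP rR /andP[/exists_inP[q qQ /andP[q1 q2]] /exists_inP[s sS /andP[s1 s2]]]]]] :
    exists p r, [/\ p \in P, r \in R & ok p r].
  by exists p, q, r, s; rewrite eq_sym q1 q2 eq_sym s2 s1.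
have [?|n11] := boolP (ok p1 r1); first by exists p1, r1.
have [?|n12] := boolP (ok p1 r2); first by exists p1, r2.
have [?|n21] := boolP (ok p2 r1); first by exists p2, r1.
exfalso; move: n11 n12 n21; rewrite !negb_and.
have one (X : {set C}) : 1 < #|X| -> forall p r p' r', p \in P -> r \in R -> p' \in P -> r' \in R ->
    ~~ [exists q in X, (q != p) && (q != r)] -> ~~ [exists q in X, (q != p') && (q != r')] ->
    p = p' /\ r = r'.
  move=> hX p r p' r' pP rR pP' rR' /(spoil _ _ _ hX)[a [b c]] /(spoil _ _ _ hX)[a' [b' c']].
  move: (subsetP c' _ a) (subsetP c' _ b); rewrite !inE (negbTE (PR _ _ pP rR')) orbF.
  by rewrite eq_sym (eq_sym r) (negbTE (PR _ _ pP' rR)) /= => /eqP-> /eqP->.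
case/orP=> a11; case/orP=> a12; case/orP=> a21.
- by have [_ E] := one Q hQ _ _ _ _ p1P r1R p1P r2R a11 a12; rewrite E eqxx in r12.
- by have [_ E] := one Q hQ _ _ _ _ p1P r1R p1P r2R a11 a12; rewrite E eqxx in r12.
- by have [E _] := one Q hQ _ _ _ _ p1P r1R p2P r1R a11 a21; rewrite E eqxx in p12.
- by have [E _] := one S hS _ _ _ _ p1P r2R p2P r1R a12 a21; rewrite E eqxx in p12.
- by have [E _] := one Q hQ _ _ _ _ p1P r2R p2P r1R a12 a21; rewrite E eqxx in p12.
- by have [E _] := one S hS _ _ _ _ p1P r1R p2P r1R a11 a21; rewrite E eqxx in p12.
- by have [_ E] := one S hS _ _ _ _ p1P r1R p1P r2R a11 a12; rewrite E eqxx in r12.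
- by have [_ E] := one S hS _ _ _ _ p1P r1R p1P r2R a11 a12; rewrite E eqxx in r12.
Qed.

(** * Reductions by list colouring *)

Definition edges (T : finType) (e : rel T) : {set T * T} := [set p | e p.1 p.2].

Definition nbl (T : finType) (e : rel T) (v : T) (l : seq T) := forall u, e v u = (u \in l).

Section Step.
Variables (T : finType) (h e : rel T) (D : nat).
Hypotheses (se : symmetric e) (ie : irreflexive e) (eh : subrel e h).
Hypothesis degD : forall v, degree e v <= D.
Hypothesis IH : forall e' : rel T, symmetric e' -> subrel e' h -> (forall v, degree e' v <= D) ->
  #|edges e'| < #|edges e| -> exists c : T -> T -> 'I_(D + 2), tcol e' c.

Lemma degree_nbl v l : uniq l -> nbl e v l -> degree e v = size l.
Proof.
by move=> U E; rewrite -(card_uniqP U) /degree; apply: eq_card => u; rewrite inE E.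
Qed.

Lemma del_sym F : symmetric (del e F).
Proof. by move=> u v; rewrite /del /= se; congr (_ && _); rewrite andbC. Qed.

Lemma del_colouring (F : {set T}) u v : u \in F -> e u v ->
  exists c : T -> T -> 'I_(D + 2), tcol (del e F) c.
Proof.
move=> uF euv; apply: IH.
- exact: del_sym.
- by move=> x y /and3P[/eh].
- move=> x; apply: leq_trans (degD x); apply/subset_leq_card/subsetP => y.
  by rewrite !inE => /and3P[].
- apply: proper_card; apply/properP; split; first by apply/subsetP => -[x y]; rewrite !inE => /and3P[].
  by exists (u, v); rewrite inE /= ?euv // /del /= uF andbF.
Qed.

Lemma card_avail (F S : {set T}) (c : T -> T -> 'I_(D + 2)) x :
  S \subset F -> {in S, forall s, e x s} -> #|S| + D < #|~: used e F c x| + degree e x.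
Proof.
move=> SF eS; have := used_degree c SF eS; have := cardsC (used e F c x).
by rewrite card_ord; lia.
Qed.

Lemma card_avail' (F S : {set T}) (c : T -> T -> 'I_(D + 2)) x :
  S \subset F -> {in S, forall s, e x s} -> #|S| < #|~: used e F c x|.
Proof. by move=> SF eS; have := card_avail c SF eS; have := degD x; lia. Qed.

(** The edges at [s] are coloured greedily in the order of [l]: at least [D + 2 - degree e x]
    colours are free at [x], and [index x l] of them may be taken. The vertex [s] comes last. *)
Lemma reduce_star s l : uniq l -> nbl e s l -> 0 < size l -> (size l).*2 < D + 2 ->
  (forall x, x \in l -> index x l + degree e x < D + 2) ->
  exists c : T -> T -> 'I_(D + 2), tcol e c.
Proof.
move=> U Ns l0 lD lx; pose F := [set s].
have [x0 x0l] : exists x0, x0 \in l by case: (l) l0 => // a l' _; exists a; rewrite mem_head.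
have [|c0 c0P] := @del_colouring F s x0 (set11 s) _; first by rewrite Ns.
have [|f [fa fi]] := @distinct_choice _ _ l (fun x => ~: used e F c0 x) (c0 s s) U.
  move=> x xl; have := lx x xl.
  have sub : {in F, forall y, e x y} by move=> y; rewrite inE => /eqP->; rewrite se Ns.
  by have := card_avail c0 (subxx F) sub; rewrite cards1; lia.
apply: (extend_independent (F := F) (e' := del e F) (c0 := c0) (f := fun=> f) se c0P).
- by move=> u v uF vF euv; rewrite /del /= euv uF.
- by move=> u v; rewrite !inE => /eqP-> /eqP->; rewrite ie.
- by move=> u; rewrite inE => /eqP->; rewrite card_ord (degree_nbl U Ns).
- move=> u x y; rewrite inE => /eqP->; rewrite !Ns => xl yl; apply: contra => /eqP E.
  by apply/eqP/fi.
- by move=> u x; rewrite inE => /eqP->; rewrite Ns => /fa; rewrite inE.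
- by move=> u v x; rewrite !inE => /eqP-> /eqP-> _ _; rewrite eqxx.
Qed.

(** The edges [sb] and [tc] are coloured first. Then [sw], [sa], [ta], [tw] form a 4-cycle in the
    line graph: three colours are free at [w] and at [a], and each edge loses at most one more. The
    bound on [D] leaves a colour for [s] and [t]. *)
Lemma reduce_pair s t w a b c : 5 <= D ->
  uniq [:: s; t; w; a; b] -> uniq [:: s; t; w; a; c] ->
  nbl e s [:: w; a; b] -> nbl e t [:: w; a; c] ->
  exists c : T -> T -> 'I_(D + 2), tcol e c.
Proof.
move=> D5 Us Ut Ns Nt; have D7 : 3.*2 < D + 2 by lia.
 pose F := [set s; t].
have esw : e s w by rewrite Ns mem_head.
have [|c0 c0P] := @del_colouring F s w _ esw; first by rewrite !inE eqxx.
move: (Us) (Ut); rewrite /= !inE !negb_or.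
case/and5P=> /and4P[st sw sa sb] /and3P[tw ta tb] /andP[wa wb] ab _.
case/and5P=> /and4P[_ _ _ sc] /and3P[_ _ tc] /andP[_ wc] ac _.
pose av x := ~: used e F c0 x.
have av3 x : e s x -> e t x -> 3 <= #|av x|.
  move=> esx etx.
  have sub : {in F, forall y, e x y} by move=> y; rewrite !inE => /orP[]/eqP->; rewrite se.
  by have := card_avail' c0 (subxx F) sub; rewrite cards2 st.
have av2 x y : y \in F -> e x y -> 2 <= #|av x|.
  move=> yF exy; have sub : {in [set y], forall z, e x z} by move=> z; rewrite inE => /eqP->.
  have yF' : [set y] \subset F by rewrite sub1set.
  by have := card_avail' c0 yF' sub; rewrite cards1.
have esb : e s b by rewrite Ns !inE eqxx !orbT.
have etc' : e t c by rewrite Nt !inE eqxx !orbT.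
have [kb kbA _] : exists2 k, k \in av b & k \notin [::].
  by apply: pick_notin; apply: ltnW; apply: (av2 b s); rewrite ?inE ?eqxx // se.
(* If [b = c], the two edges meet and need different colours. *)
have [kc kcA kbc] : exists2 k, k \in av c & k \notin (if b == c then [:: kb] else [::]).
  have h2 : 2 <= #|av c| by apply: (av2 c t); rewrite ?inE ?eqxx ?orbT // se.
  by apply: pick_notin; case: (b == c); [exact: h2 | exact: ltnW].
have D1 x k : 3 <= #|av x| -> 1 < #|av x :\ k|.
  by rewrite (cardsD1 k (av x)); case: (k \in av x); [rewrite add1n | exact: ltnW].
have w3 : 3 <= #|av w| by apply: av3; rewrite ?Ns ?Nt mem_head.
have a3 : 3 <= #|av a| by apply: av3; rewrite ?Ns ?Nt !inE eqxx orbT.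
have [p [q [r [z [[pA qA rA zA] [pq qr rz zp]]]]]] :=
  four_cycle_choice (D1 w kb w3) (D1 a kb a3) (D1 a kc a3) (D1 w kc w3).
move: pA qA rA zA; rewrite !in_setD1.
case/andP=> pb pA; case/andP=> qb qA; case/andP=> rc rA; case/andP=> zc zA.
pose f u x := if u == s then (if x == w then p else if x == a then q else kb)
              else (if x == w then z else if x == a then r else kc).
have ts : (t == s) = false by rewrite eq_sym (negbTE st).
have aw : (a == w) = false by rewrite eq_sym (negbTE wa).
have bw : (b == w) = false by rewrite eq_sym (negbTE wb).
have cw : (c == w) = false by rewrite eq_sym (negbTE wc).
have ba : (b == a) = false by rewrite eq_sym (negbTE ab).
have ca : (c == a) = false by rewrite eq_sym (negbTE ac).
have fs : (f s w = p) * (f s a = q) * (f s b = kb).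
  by rewrite /f !eqxx aw bw ba.
have ft : (f t w = z) * (f t a = r) * (f t c = kc).
  by rewrite /f !eqxx ts aw cw ca.
have in3 (P : T -> Prop) x1 x2 x3 x : P x1 -> P x2 -> P x3 -> x \in [:: x1; x2; x3] -> P x.
  by move=> P1 P2 P3; rewrite !inE => /or3P[]/eqP->.
apply: (extend_independent (F := F) (e' := del e F) (c0 := c0) (f := f) se c0P).
- by move=> u v uF vF euv; rewrite /del /= euv uF.
- move=> u v; rewrite !inE => /orP[]/eqP-> /orP[]/eqP->; rewrite ?ie //.
    by rewrite Ns !inE !negb_or tw ta tb.
  by rewrite se Ns !inE !negb_or tw ta tb.
- move=> u; rewrite !inE card_ord => /orP[]/eqP->.
    by rewrite (degree_nbl (drop_uniq 2 Us) Ns).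
  by rewrite (degree_nbl (drop_uniq 2 Ut) Nt).
- move=> u x y; rewrite !inE => /orP[]/eqP->.
    rewrite !Ns !inE => /or3P[]/eqP-> /or3P[]/eqP->; rewrite ?eqxx ?fs // => _;
      by rewrite // eq_sym.
  rewrite !Nt !inE => /or3P[]/eqP-> /or3P[]/eqP->; rewrite ?eqxx ?ft // => _;
    by rewrite // eq_sym.
- move=> u x; rewrite in_set2 => /orP[]/eqP->.
    by rewrite Ns -in_setC; apply: (in3 (fun y => f s y \in av y)); rewrite fs.
  by rewrite Nt -in_setC; apply: (in3 (fun y => f t y \in av y)); rewrite ft.
- suff st_ok x : e s x -> e t x -> f s x != f t x.
    move=> u v x; rewrite !inE => /orP[]/eqP-> /orP[]/eqP-> e1 e2; rewrite ?eqxx // => _.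
      exact: st_ok.
    by rewrite eq_sym; exact: st_ok.
  rewrite Ns !inE => /or3P[]/eqP->; rewrite fs.
  - by move=> _; rewrite ft eq_sym.
  - by move=> _; rewrite ft.
  - rewrite Nt !inE bw ba /= => /eqP E; move: kbc.
    by rewrite E eqxx ft inE eq_sym.
Qed.
End Step.

(** * The cases of maximum degree at least 3 *)

Section Cases.
Variables (T : finType) (h e : rel T) (D : nat).
Hypotheses (se : symmetric e) (ie : irreflexive e) (eh : subrel e h).
Hypothesis hs : symmetric h.
Hypothesis degD : forall v, degree e v <= D.
Hypothesis IH : forall e' : rel T, symmetric e' -> subrel e' h -> (forall v, degree e' v <= D) ->
  #|edges e'| < #|edges e| -> exists c : T -> T -> 'I_(D + 2), tcol e' c.

Local Notation colourable := (exists c : T -> T -> 'I_(D + 2), tcol e c).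

Section Engine.
Variables (K : nat) (t : template) (x0 : T) (L : seq T) (od : seq nat).
Hypotheses (KD : K = D + 2) (fit : fits D t (size L) od) (UL : uniq L).
Hypothesis nbL : forall i, i < nfull t -> nbl e (nth x0 L i) [seq nth x0 L j | j <- nb t i].
Local Notation F := (full_set t L).

Lemma engine_del : exists c : T -> T -> 'I_(D + 2), tcol (del e F) c.
Proof.
have v0 := v0F x0 fit UL 0.
case/and5P: (fit) => _ _ nf0 nb0 _.
have [j jn] : exists j, j \in nb t 0 by case: (nb t 0) nb0 => // a l _; exists a; rewrite mem_head.
by apply: (del_colouring se eh degD IH v0 (v := nth x0 L j)); rewrite nbL //; apply: map_f.
Qed.

Let ee' u v : u \notin F -> v \notin F -> e u v -> del e F u v.
Proof. by move=> uF vF euv; rewrite /del /= euv uF. Qed.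

(** [K] is kept apart from [D + 2] so that the checks, stated with numerals, apply directly. *)
Lemma engine_solved : check K od xpredT (solved K t) -> colourable.
Proof.
move: KD => -> chk; have [c0 c0P] := engine_del.
exact: (reduce_solved se ie degD fit UL nbL ee' chk c0P).
Qed.

Lemma engine_recol j : check K od xpredT (recol K t j) -> j < size od ->
  (nth 0 od j).*2.+1 < K -> colourable.
Proof.
move: KD => -> chk; have [c0 c0P] := engine_del.
exact: (reduce_recol se ie degD fit UL nbL ee' chk c0P).
Qed.

Lemma engine_recol2 Y : check K od xpredT (recol2 K t) -> 1 < size od ->
  (forall y, y \notin F -> e (nth x0 L (nfull t + 0)) y ->
     y = nth x0 L (nfull t + 1) \/ y = Y) -> colourable.
Proof.
move: KD => -> chk; have [c0 c0P] := engine_del.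
exact: (reduce_recol2 se ie degD fit UL nbL ee' chk c0P).
Qed.
End Engine.

Lemma nbl_eq v l l' : l =i l' -> nbl e v l -> nbl e v l'.
Proof. by move=> E N u; rewrite N E. Qed.

Lemma nbl_of v l : uniq l -> all (e v) l -> degree e v <= size l -> nbl e v l.
Proof.
move=> U /allP ev dv u.
have sub : [set x in l] \subset [set x | e v x].
  by apply/subsetP => x; rewrite !inE; exact: ev.
have cl : #|[set x in l]| = size l by rewrite cardsE; exact/card_uniqP.
have : [set x in l] == [set x | e v x] by rewrite eqEcard sub cl.
by move/eqP/setP/(_ u); rewrite !inE.
Qed.

Section Configuration.
Variables (w : T) (A S : {set T}).
Hypotheses (A3 : #|A| <= 3) (Ah : {in A &, forall x y, x != y -> h x y}).
Hypotheses (wA : w \notin A) (S0 : S != set0) (Nw : nbhd e w \subset A :|: S).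
Hypothesis dw : 3 <= degree e w.
Hypothesis NS : forall s, s \in S -> exists x y, [/\ x \in A, y \in A, x != y, s \notin A &
      nbhd e s = [set w; x; y]].

Lemma nbS s : s \in S -> exists a b, [/\ a \in A, b \in A, a != b & nbl e s [:: w; a; b]].
Proof.
move=> /NS[a [b [aA bA ab _ E]]]; exists a, b; split=> // u.
by have /setP/(_ u) := E; rewrite !inE orbA.
Qed.

Lemma eSw s : s \in S -> e s w.
Proof. by case/nbS => a [b [_ _ _ ->]]; rewrite mem_head. Qed.

Lemma uniq_config Ss As : uniq Ss -> uniq As -> {subset Ss <= S} -> {subset As <= A} ->
  uniq (Ss ++ w :: As).
Proof.
move=> US UA sS sA; rewrite cat_uniq US /= UA andbT negb_or -!andbA; apply/and3P; split.
- by apply/negP => /sS/eSw; rewrite ie.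
- by apply/hasPn => a /sA aA; apply/negP => /sS/NS[? [? [_ _ _ + _]]]; rewrite aA.
- by apply: contra wA => /sA.
Qed.

Lemma listA a b : a \in A -> b \in A -> a != b ->
  exists l, [/\ uniq (a :: b :: l), A =i a :: b :: l & size l <= 1].
Proof.
move=> aA bA ab; exists (enum (A :\: [set a; b])).
have E : A =i a :: b :: enum (A :\: [set a; b]).
  move=> u; rewrite !inE mem_enum !inE; case: (u =P a) => [->//|_]; by case: (u =P b) => [->|].
have U : uniq (a :: b :: enum (A :\: [set a; b])).
  by rewrite /= inE !mem_enum !inE !eqxx !orbT /= enum_uniq orbF ab.
split=> //; rewrite -ltnS -ltnS -[_.+2]/(size (a :: b :: enum (A :\: [set a; b]))).
by rewrite -(card_uniqP U) -(eq_card E).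
Qed.

(** Two 2-element subsets of a set of at most three elements coincide, or share one element [a] and
    together exhaust the set. *)
Lemma pairS s t : s \in S -> t \in S ->
  (exists a b, [/\ a \in A, b \in A, a != b, nbl e s [:: w; a; b] & nbl e t [:: w; a; b]]) \/
  (exists a b c, [/\ uniq [:: a; b; c], A =i [:: a; b; c], nbl e s [:: w; a; b] &
     nbl e t [:: w; a; c]]).
Proof.
move=> /nbS[a [b [aA bA ab Ns]]] /nbS[a' [b' [a'A b'A ab' Nt]]].
have [l [U E l1]] := listA aA bA ab.
have twin : (a' == a) && (b' == b) || (a' == b) && (b' == a) -> nbl e t [:: w; a; b].
  by case/orP=> /andP[/eqP ea /eqP eb]; apply: nbl_eq Nt => u; rewrite !inE ea eb // [(u == a) || _]orbC.
have {}Nt' : nbl e t [:: w; b'; a'].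
  by apply: nbl_eq Nt => u; rewrite !inE [(u == a') || _]orbC.
have Ns' : nbl e s [:: w; b; a].
  by apply: nbl_eq Ns => u; rewrite !inE [(u == a) || _]orbC.
case: l U E l1 => [|c [|//]] U E _.
  left; exists a, b; split=> //; apply: twin; move: a'A b'A ab'; rewrite !E !inE.
  by case/orP=> /eqP-> /orP[] /eqP->; rewrite ?eqxx ?orbT.
move: a'A b'A ab'; rewrite !E !inE.
have Ub : uniq [:: b; a; c].
  by move: U; rewrite /= !inE !negb_or eq_sym => /and3P[/andP[-> ->] -> _].
have Eb : A =i [:: b; a; c] by move=> u; rewrite E !inE orbCA.
case/or3P=> /eqP ea /or3P[] /eqP eb; rewrite ea eb ?eqxx // => _; subst a' b'.
- by left; exists a, b.
- by right; exists a, b, c.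
- by left; exists a, b.
- by right; exists b, a, c.
- by right; exists a, b, c.
- by right; exists b, a, c.
Qed.

Lemma colourable_ge5 : 5 <= D -> colourable.
Proof.
move=> D5; have /set0Pn[s sS] := S0.
have [/existsP[t /andP[tS st]]|only] := boolP [exists t, (t \in S) && (s != t)].
  have US : uniq [:: s; t] by rewrite /= inE st.
  have sS2 : {subset [:: s; t] <= S} by move=> u; rewrite !inE => /orP[]/eqP->.
  case: (pairS sS tS) => [[a [b [aA bA ab Ns Nt]]]|[a [b [c [U E Ns Nt]]]]].
    have UL : uniq [:: s; t; w; a; b].
      apply: (@uniq_config [:: s; t] [:: a; b]) => //; first by rewrite /= inE ab.
      by move=> u; rewrite !inE => /orP[]/eqP->.
    exact: (reduce_pair se ie eh degD IH D5 UL UL Ns Nt).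
  have Ub : uniq [:: a; b] by move: U; rewrite /= !inE negb_or => /and3P[/andP[->]].
  have Uc : uniq [:: a; c] by move: U; rewrite /= !inE negb_or => /and3P[/andP[_ ->]].
  apply: (reduce_pair se ie eh degD IH D5 _ _ Ns Nt).
    apply: (@uniq_config [:: s; t] [:: a; b]) => // u.
    by rewrite E !inE => /orP[]->; rewrite ?orbT.
  apply: (@uniq_config [:: s; t] [:: a; c]) => // u.
  by rewrite E !inE => /orP[]->; rewrite ?orbT.
have {}only t : t \in S -> t = s.
  by move=> tS; apply/eqP/negPn/negP => ts; case/existsP: only; exists t; rewrite tS eq_sym.
have [a [b [aA bA ab Ns]]] := nbS sS.
(* Here [S] has one element and [A] at most three. So [w] may come third in the greedy order, after
   [a] and [b]: [2 + 4 < D + 2]. *)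
have dw4 : degree e w <= 4.
  apply: leq_trans (subset_leq_card Nw) _.
  apply: leq_trans (leq_card_setU _ _) _; rewrite -[4]/(3 + 1) leq_add //.
  rewrite -(cards1 s); apply/subset_leq_card/subsetP => t /only->; exact: set11.
have Ns' : nbl e s [:: a; b; w] by apply: nbl_eq Ns => u; rewrite !inE orbCA [(_ == w) || _]orbC.
have U : uniq [:: a; b; w].
  have : uniq ([::] ++ w :: [:: a; b]).
    apply: uniq_config => //; first by rewrite /= inE ab.
    by move=> u; rewrite !inE => /orP[]/eqP->.
  by rewrite -(rot_uniq 1).
have [da db] := (degD a, degD b).
apply: (reduce_star se ie eh degD IH U Ns') => //=; first by lia.
move=> x; rewrite !inE; case: (x =P a) => [->|_].
  by rewrite /= eqxx; lia.
case: (x =P b) => [->|_] /=; first by rewrite (negbTE ab) eqxx; lia.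
move=> /eqP->; move: U; rewrite /= !inE !negb_or => /and3P[/andP[_ aw] bw _].
by rewrite (negbTE aw) (negbTE bw) eqxx; lia.
Qed.
Lemma colourable_hub s a b c : D = 4 -> uniq [:: s; w; a; b; c] ->
  nbl e s [:: w; a; b] -> nbl e w [:: s; a; b; c] -> colourable.
Proof.
move=> D4 UL Ns Nw'.
have fit : fits D tmpl_leaf_hub4 5 [:: 2; 2; 3] by rewrite D4.
have esw : e s w by rewrite Ns mem_head.
(* Only the edges at [s] are deleted, so [w] is coloured too; the template then recolours both [s]
   and [w]. *)
have [c0 c0P] := del_colouring se eh degD IH (set11 s) esw.
have FE : full_set tmpl_leaf_hub4 [:: s; w; a; b; c] = [set s; w] by apply/setP => u; rewrite !inE.
have chk : check (D + 2) [:: 2; 2; 3] xpredT (solved_or_no_hub (D + 2) tmpl_leaf_hub4).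
  by rewrite D4; exact: check_leaf_hub4.
apply: (reduce_hub se ie degD (x0 := s) (L := [:: s; w; a; b; c]) fit UL _ _ chk c0P) => //.
- by case=> [|[|//]] _.
- by move=> u v; rewrite FE !inE !negb_or /del /= !inE => /andP[-> _] /andP[-> _] ->.
- exact: del_sym.
- move: UL; rewrite cons_uniq !inE !negb_or => /andP[/and4P[sw sa sb sc] _].
  by case=> [|[|[|//]]] _; rewrite /del /= Nw' !inE ?eqxx ?orbT eq_sym sw eq_sym ?sa ?sb ?sc.
Qed.

(** Besides [s], the vertex [w] has two or three neighbours in [A]. They are [a] and [b], or one of
    these and the third element [c], or all three; the last forces [D = 4]. *)
Lemma colourable_single K od1 od2 s : K = D + 2 ->
  check K od1 xpredT (solved K tmpl_leaf_one_common) -> fits D tmpl_leaf_one_common 5 od1 ->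
  check K od2 xpredT (solved K tmpl_leaf_two_common) -> fits D tmpl_leaf_two_common 4 od2 -> D <= 4 -> S =i [:: s] -> colourable.
Proof.
move=> KD chk1 fit1 chk2 fit2 D4 SE.
have sS : s \in S by rewrite SE mem_head.
have [a [b [aA bA ab Ns]]] := nbS sS.
have [l [U E l1]] := listA aA bA ab.
have sub : {subset a :: b :: l <= A} by move=> u; rewrite E.
have sS' : {subset [:: s] <= S} by move=> u; rewrite SE.
have UL := @uniq_config [:: s] _ isT U sS' sub.
have Nw' : nbl e w (s :: [seq u <- a :: b :: l | e w u]).
  move=> u; rewrite in_cons mem_filter -E; case: (u =P s) => [->|us] /=.
    by rewrite se eSw.
  case ewu: (e w u) => //=; apply/esym.
  have := subsetP Nw u; rewrite inE ewu => /(_ isT); rewrite inE SE inE.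
  by case: eqP us => // _ _; rewrite orbF.
have Us : uniq (s :: [seq u <- a :: b :: l | e w u]).
  rewrite /= -/(filter _ (a :: b :: l)) filter_uniq // andbT mem_filter negb_and; apply/orP; right.
  by apply/negP => /sub sA; have [? [? [_ _ _ + _]]] := NS sS; rewrite sA.
have dE := degree_nbl Us Nw'; have dD := degD w; rewrite dE in dD.
have := dw; rewrite dE.
case: l U E l1 sub UL Nw' Us dE dD => [|c [|//]] U E _ sub UL Nw' Us dE dD.
  move: Nw' => /=; case: (e w a); case: (e w b) => // Nw' _.
  by apply: (@engine_solved K tmpl_leaf_two_common w [:: s; w; a; b] od2 KD fit2 UL _ chk2); case=> [|[|//]].
have swap : {subset [:: b; a; c] <= A} by move=> u; rewrite E !inE orbCA.
have Ub : uniq [:: b; a; c].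
  by move: U; rewrite /= !inE !negb_or eq_sym => /and3P[/andP[-> ->] -> _].
have Ns' : nbl e s [:: w; b; a].
  by apply: nbl_eq Ns => u; rewrite !inE [(u == a) || _]orbC.
move: Nw' dD => /=; case: (e w a); case: (e w b); case: (e w c) => //= Nw' dD _.
- apply: (colourable_hub _ UL Ns Nw'); apply/eqP; rewrite eqn_leq D4.
  exact: dD.
- have UL2 : uniq [:: s; w; a; b].
    by apply: subseq_uniq UL; rewrite /= !eqxx.
  by apply: (@engine_solved K tmpl_leaf_two_common w [:: s; w; a; b] od2 KD fit2 UL2 _ chk2); case=> [|[|//]].
- by apply: (@engine_solved K tmpl_leaf_one_common w [:: s; w; a; b; c] od1 KD fit1 UL _ chk1); case=> [|[|//]].
- have UL2 := @uniq_config [:: s] _ isT Ub sS' swap.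
  by apply: (@engine_solved K tmpl_leaf_one_common w [:: s; w; b; a; c] od1 KD fit1 UL2 _ chk1); case=> [|[|//]].
Qed.

(** When [b] and [c] have different colours, the colouring extends, if need be after a recolouring
    of [w]. The added edge [bc] belongs to [h], and it respects the degree bound because [b] loses
    [s] and [c] loses [t]. *)
Lemma colourable_fork s t a b c : D = 4 -> s \in S -> t \in S -> s != t ->
  uniq [:: a; b; c] -> {subset [:: a; b; c] <= A} ->
  nbl e s [:: w; a; b] -> nbl e t [:: w; a; c] -> colourable.
Proof.
move=> D4 sS tS st U sub Ns Nt.
have UL : uniq [:: s; t; w; a; b; c].
  apply: (@uniq_config [:: s; t]) => //; first by rewrite /= inE st.
  by move=> u; rewrite !inE => /orP[]/eqP->.
have fit : fits D tmpl_fork 6 [:: 2; 2; 3; 3] by rewrite D4.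
pose F := full_set tmpl_fork [:: s; t; w; a; b; c].
have FE : F = [set s; t] by apply/setP => u; rewrite !inE.
(* adding the edge bc makes b and c receive different colours *)
pose e' := [rel u v | del e F u v || ((u, v) == (b, c)) || ((u, v) == (c, b))].
have bc : b != c by move: U; rewrite /= !inE => /and3P[_ ->].
have esw : e s w by rewrite Ns mem_head.
have esa : e s a by rewrite Ns !inE eqxx orbT.
have esb : e s b by rewrite Ns !inE eqxx !orbT.
have etc' : e t c by rewrite Nt !inE eqxx !orbT.
have hbc : h b c by apply: Ah bc; apply: sub; rewrite !inE eqxx ?orbT.
have degdel x y z : y \in F -> e y x -> e' x =1 [predU1 z & del e F x] -> degree e' x <= D.
  move=> yF eyx ex; apply: leq_trans (degD x); rewrite /degree.
  rewrite [X in _ <= X](cardsD1 y) inE se eyx.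
  have : [set u | e' x u] \subset z |: [set u | e x u] :\ y.
    apply/subsetP => u; rewrite in_set ex => /orP[/eqP->|/and3P[exu _ uF]].
      exact: setU11.
    by rewrite in_setU1 in_setD1 in_set exu (contraNneq _ uF) ?orbT // => ->.
  move/subset_leq_card/leq_trans; apply; rewrite cardsU1.
  by rewrite leq_add2r leq_b1.
have [|||| c0 c0P] := IH (e' := e').
- move=> u v; rewrite /e' /= del_sym // -!orbA; congr (_ || _).
  by rewrite orbC !xpair_eqE [(u == b) && _]andbC [(u == c) && _]andbC.
- move=> u v /orP[/orP[/and3P[/eh//]|]|] /eqP[-> ->] //; by rewrite hs.
- move=> x; have [->|xb] := eqVneq x b.
    apply: (@degdel b s c) => //; first by rewrite FE !inE eqxx.
    by move=> u; rewrite /e' /= !xpair_eqE eqxx (negbTE bc) /= orbF orbC.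
  have [->|xc] := eqVneq x c.
    apply: (@degdel c t b) => //; first by rewrite FE !inE eqxx orbT.
    by move=> u; rewrite /e' /= !xpair_eqE eqxx eq_sym (negbTE bc) /= orbF orbC.
  apply: leq_trans (degD x); apply/subset_leq_card/subsetP => u.
  by rewrite !in_set /e' /= !xpair_eqE (negbTE xb) (negbTE xc) !orbF => /and3P[].
(* Edges are counted as ordered pairs: two are added, and at least the three pairs starting in [s]
   disappear. *)
- have sub1 : edges e' \subset edges (del e F) :|: [set (b, c); (c, b)].
    by apply/subsetP => -[u v]; rewrite !inE /e' /= orbA.
  have sub2 : edges (del e F) :|: [set x in [:: (s, w); (s, a); (s, b)]] \subset edges e.
    apply/subsetP => -[u v]; rewrite !inE /= => /orP[/and3P[]//|].
    by rewrite !xpair_eqE; case/or3P=> /andP[/eqP-> /eqP->].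
  have dis : edges (del e F) :&: [set x in [:: (s, w); (s, a); (s, b)]] = set0.
    apply/setP => -[u v]; rewrite in_set0 !in_setI !in_set /=; apply/negP => /andP[/and3P[_ uF _]].
    by rewrite !inE !xpair_eqE -!andb_orr => /andP[/eqP us _]; move: uF; rewrite us FE !inE eqxx.
  have Uw : uniq [:: (s, w); (s, a); (s, b)].
    rewrite /= !inE !xpair_eqE !eqxx /=; move: (drop_uniq 2 UL); rewrite /= !inE !negb_or.
    by case/and4P=> /and3P[-> -> _] /andP[->].
  have := subset_leq_card sub2.
  rewrite -[X in X <= _]addn0 -(cards0 (T * T)%type) -dis cardsUI [X in _ + X]cardsE (card_uniqP Uw).
  apply: leq_trans; apply: leq_ltn_trans (subset_leq_card sub1) _.
  apply: leq_ltn_trans (leq_card_setU _ _) _.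
  by rewrite ltn_add2l cards2 xpair_eqE negb_and bc.
have chk : check (D + 2) [:: 2; 2; 3; 3] (fun vs => nth 0 vs 2 != nth 0 vs 3) (recol (D + 2) tmpl_fork 0).
  by rewrite D4; exact: check_fork.
have nbF i : i < nfull tmpl_fork -> nbl e (nth s [:: s; t; w; a; b; c] i)
    [seq nth s [:: s; t; w; a; b; c] j | j <- nb tmpl_fork i].
  by case: i => [|[|//]].
apply: (reduce_recol se ie degD (x0 := s) (L := [:: s; t; w; a; b; c]) fit UL nbF _ chk c0P).
- by move=> u v uF vF euv; rewrite /e' /= /del /= euv uF vF.
- move=> k [_ k2 _ _]; rewrite /= val_eqE; apply: k2.
  by rewrite /e' /= eqxx orbT.
- by [].
- by rewrite D4.
Qed.
Lemma nbl_swap s a b : nbl e s [:: w; a; b] -> nbl e s [:: w; b; a].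
Proof. by apply: nbl_eq => u; rewrite !inE [(u == a) || _]orbC. Qed.

Lemma same_nbl s t l a b : nbl e s l -> nbl e t l -> nbl e s [:: w; a; b] -> nbl e t [:: w; a; b].
Proof. by move=> N1 N2 N3 u; rewrite N2 -N1 N3. Qed.

(** [w] has at most two neighbours besides [s] and [t], since its degree is at most 4. With [a] and
    [b] suitably ordered, its outer neighbours are among the first boundary neighbour and one vertex
    [Y], so two helpful colours for [w] suffice. *)
Lemma colourable_twins s t a b l : D = 4 -> S =i [:: s; t] -> s != t ->
  uniq (a :: b :: l) -> A =i a :: b :: l -> size l <= 1 ->
  nbl e s [:: w; a; b] -> nbl e t [:: w; a; b] -> colourable.
Proof.
move=> D4 SE st U E l1 Ns Nt.
have fit : fits D tmpl_twins 5 [:: 2; 2; 2] by rewrite D4.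
have KD : 6 = D + 2 by rewrite D4.
have US : uniq [:: s; t] by rewrite /= inE st.
have sS : {subset [:: s; t] <= S} by move=> u; rewrite SE.
have main a' b' Y : uniq [:: a'; b'] -> {subset [:: a'; b'] <= A} ->
    nbl e s [:: w; a'; b'] -> nbl e t [:: w; a'; b'] ->
    (forall y, y \in A -> e w y -> y = a' \/ y = Y) -> colourable.
  move=> Uab sub Ns' Nt' wY; have UL := uniq_config US Uab sS sub.
  apply: (@engine_recol2 6 tmpl_twins w [:: s; t; w; a'; b'] _ KD fit UL _ Y check_twins) => //.
    by case=> [|[|//]].
  move=> y; rewrite inE => yF /= ewy; apply: wY => //.
  have := subsetP Nw y; rewrite inE ewy => /(_ isT); rewrite inE SE => /orP[//|yS].
  by rewrite /= yS in yF.
have Uab : uniq [:: a; b] by move: U; rewrite /= !inE !negb_or => /andP[/andP[->]].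
have Uba : uniq [:: b; a] by move: Uab; rewrite /= !inE eq_sym.
have sab : {subset [:: a; b] <= A} by move=> u; rewrite E !inE => /orP[]->; rewrite ?orbT.
have sba : {subset [:: b; a] <= A} by move=> u; rewrite E !inE => /orP[]->; rewrite ?orbT.
have [wb|wb] := boolP (e w b); last first.
  apply: (main a b (head a l)) => // y; rewrite E !inE => /or3P[/eqP->|/eqP->|yl]; first by left.
    by rewrite (negbTE wb).
  by right; case: (l) l1 yl => [|c [|//]] //= _; rewrite inE => /eqP.
have [wa|wa] := boolP (e w a); last first.
  apply: (main b a (head a l)) => //; try exact: nbl_swap.
  move=> y; rewrite E !inE => /or3P[/eqP->|/eqP->|yl]; first by rewrite (negbTE wa).
    by left.
  by right; case: (l) l1 yl => [|c [|//]] //= _; rewrite inE => /eqP.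
apply: (main a b b) => // y; rewrite E !inE => /or3P[/eqP->|/eqP->|yl]; [by left | by right |].
move=> ewy; exfalso.
have Uy : uniq [:: s; t; a; b; y].
  have : uniq ([:: s; t] ++ w :: [:: a; b; y]).
    apply: uniq_config => //.
      move: U; rewrite /= !inE !negb_or => /and3P[/andP[ab al] bl _].
      by rewrite ab /= andbT; apply/andP; split; [apply: contraNneq al => -> | apply: contraNneq bl => ->].
    by move=> u; rewrite E !inE => /or3P[/eqP->|/eqP->|/eqP->]; rewrite ?eqxx ?yl ?orbT.
  by apply: subseq_uniq; exact: cat_subseq (subseq_refl [:: s; t]) (subseq_cons _ w).
have := degD w; rewrite D4 leqNgt => /negP; apply.
rewrite -[5]/(size [:: s; t; a; b; y]) -(card_uniqP Uy) /degree.
apply/subset_leq_card/subsetP => u; rewrite !inE.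
by case/or4P=> [/eqP->|/eqP->|/eqP->|/orP[]/eqP->] //; rewrite se eSw // SE !inE eqxx ?orbT.
Qed.

(** Two vertices of [S] with different neighbourhoods form a fork. Otherwise [S] is a single vertex
    or a pair of twins, or it contains triplets. *)
Lemma colourable_quartic : D = 4 -> colourable.
Proof.
move=> D4; case SE': (enum S) => [|s [|t l]].
- by have /set0Pn[s] := S0; rewrite -mem_enum SE'.
- have SE : S =i [:: s] by move=> u; rewrite -mem_enum SE'.
  by apply: (@colourable_single 6 [:: 2; 3; 3] [:: 2; 2] s _ check_leaf_one_common_6 _ check_leaf_two_common_6); rewrite ?D4.
have SE : S =i s :: t :: l by move=> u; rewrite -mem_enum SE'.
have U : uniq (s :: t :: l) by rewrite -SE' enum_uniq.
have sS : s \in S by rewrite SE !inE eqxx.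
have tS : t \in S by rewrite SE !inE eqxx orbT.
have st : s != t by move: U; rewrite /= inE negb_or => /andP[/andP[]].
have fork s' t' a b c : s' \in S -> t' \in S -> s' != t' -> uniq [:: a; b; c] ->
    A =i [:: a; b; c] -> nbl e s' [:: w; a; b] -> nbl e t' [:: w; a; c] -> colourable.
  by move=> h1 h2 h3 h4 h5; apply: colourable_fork => // u; rewrite h5.
case: (pairS sS tS) => [[a [b [aA bA ab Ns Nt]]]|[a [b [c [Ua E Ns Nt]]]]]; last first.
  exact: fork sS tS st Ua E Ns Nt.
have [l' [Ul E l1]] := listA aA bA ab.
case: l SE U {SE'} => [|x l] SE U; first exact: (colourable_twins D4 SE st Ul E l1 Ns Nt).
have xS : x \in S by rewrite SE !inE eqxx !orbT.
have Ustx : uniq [:: s; t; x] by apply: subseq_uniq U; rewrite /= !eqxx sub0seq.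
have sx : s != x by move: Ustx; rewrite /= !inE negb_or => /andP[/andP[]].
case: (pairS sS xS) => [[a' [b' [_ _ _ Ns' Nx']]]|[a' [b' [c [Ua E' Ns' Nx]]]]]; last first.
  exact: fork sS xS sx Ua E' Ns' Nx.
have Nx := same_nbl Ns' Nx' Ns.
have UL : uniq [:: s; t; x; w; a; b].
  apply: (@uniq_config [:: s; t; x] [:: a; b]) => //; first by rewrite /= inE ab.
    by move=> u; rewrite !inE => /or3P[]/eqP->.
  by move=> u; rewrite !inE => /orP[]/eqP->.
have KD : 6 = D + 2 by rewrite D4.
have fit : fits D tmpl_triplets 6 [:: 1; 1; 1] by rewrite D4.
by apply: (@engine_solved 6 tmpl_triplets w [:: s; t; x; w; a; b] _ KD fit UL _ check_triplets); case=> [|[|[|//]]].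
Qed.
(** With [D = 3], a vertex adjacent to [s], [t] and [x] has no other neighbour. This applies to [w]
    and either to two vertices of [A], giving a component [K_{3,3}], or to exactly one. *)
Lemma colourable_twins_in_triple s t x a b : D = 3 -> uniq [:: s; t; x] -> {subset [:: s; t; x] <= S} ->
  a \in A -> b \in A -> a != b -> nbl e s [:: w; a; b] -> nbl e t [:: w; a; b] -> colourable.
Proof.
move=> D3 U sub aA bA ab Ns Nt.
have KD : 5 = D + 2 by rewrite D3.
have sS : s \in S by apply: sub; rewrite !inE eqxx.
have tS : t \in S by apply: sub; rewrite !inE eqxx orbT.
have xS : x \in S by apply: sub; rewrite !inE eqxx !orbT.
have nb3 v : e s v -> e t v -> e x v -> nbl e v [:: s; t; x].
  move=> e1 e2 e3; apply: nbl_of => //; last by rewrite /= -D3.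
  by rewrite /= !(se v) e1 e2 e3.
have Nw3 : nbl e w [:: s; t; x] by apply: nb3; exact: eSw.
case: (pairS sS xS) => [[a' [b' [_ _ _ Ns' Nx']]]|[a' [b' [c [Ua E Ns' Nx]]]]].
  have Nx := same_nbl Ns' Nx' Ns.
  have UL : uniq [:: s; t; x; w; a; b].
    apply: (@uniq_config [:: s; t; x] [:: a; b]) => //; first by rewrite /= inE ab.
    by move=> u; rewrite !inE => /orP[]/eqP->.
  have Na : nbl e a [:: s; t; x] by apply: nb3; rewrite ?Ns ?Nt ?Nx !inE eqxx orbT.
  have Nb : nbl e b [:: s; t; x] by apply: nb3; rewrite ?Ns ?Nt ?Nx !inE eqxx !orbT.
  have fit : fits D tmpl_K33 6 [::] by rewrite D3.
  apply: (@engine_solved 5 tmpl_K33 w [:: s; t; x; w; a; b] _ KD fit UL _ check_K33).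
  by case=> [|[|[|[|[|[|//]]]]]].
have Nt' := same_nbl Ns Nt Ns'.
have UL : uniq [:: s; t; x; w; a'; b'; c].
  by apply: (@uniq_config [:: s; t; x]) => // u; rewrite E.
have Na : nbl e a' [:: s; t; x] by apply: nb3; rewrite ?Ns' ?Nt' ?Nx !inE eqxx orbT.
have fit : fits D tmpl_twins_and_third 7 [:: 1; 2] by rewrite D3.
apply: (@engine_solved 5 tmpl_twins_and_third w [:: s; t; x; w; a'; b'; c] _ KD fit UL _ check_twins_and_third).
by case=> [|[|[|[|[|//]]]]].
Qed.

(** [w] has exactly one neighbour [y] besides [s] and [t], and it lies in [A]. The cases are whether
    [s] and [t] are twins and which element of [A] is [y]; in a fork, [y = c] follows from [y = b]
    by exchanging [s] and [t]. *)
Lemma colourable_pair_cubic s t : D = 3 -> S =i [:: s; t] -> s != t -> colourable.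
Proof.
move=> D3 SE st.
have KD : 5 = D + 2 by rewrite D3.
have sS : s \in S by rewrite SE !inE eqxx.
have tS : t \in S by rewrite SE !inE eqxx orbT.
have U2 : uniq [:: s; t] by rewrite /= inE st.
have sub2 : {subset [:: s; t] <= S} by move=> u; rewrite SE.
have [y yA ewy] : exists2 y, y \in A & e w y.
  have /subsetPn[y] : ~~ (nbhd e w \subset [:: s; t]).
    apply: contraL dw => /subset_leq_card; rewrite -leqNgt => /leq_trans; apply.
    exact: card_size.
  rewrite inE => ewy yst; exists y => //; have := subsetP Nw y; rewrite inE ewy => /(_ isT).
  by rewrite inE SE (negbTE yst) orbF.
have uU l : uniq l -> {subset l <= A} -> uniq [:: s, t, w & l].
  by move=> Ul sl; apply: (@uniq_config [:: s; t]).
have Nwy : nbl e w [:: s; t; y].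
  apply: nbl_of; last by rewrite /= -D3.
    have : uniq [:: s; t; w; y] by apply: uU => // u; rewrite inE => /eqP->.
    by apply: subseq_uniq; exact: cat_subseq (subseq_refl [:: s; t]) (subseq_cons _ w).
  by rewrite /= ewy !(se w) !eSw.
have nbA v : e s v -> e t v -> e w v -> nbl e v [:: s; t; w].
  move=> e1 e2 e3; apply: nbl_of; last by rewrite /= -D3.
    exact: (take_uniq 3 (uU [::] isT _)).
  by rewrite /= !(se v) e1 e2 e3.
case: (pairS sS tS) => [[a [b [aA bA ab Ns Nt]]]|[a [b [c [U E Ns Nt]]]]].
  have tri a' b' : a' \in A -> b' \in A -> a' != b' -> nbl e s [:: w; a'; b'] ->
      nbl e t [:: w; a'; b'] -> y = a' -> colourable.
    move=> a'A b'A ab' Ns' Nt' ya; rewrite ya in Nwy ewy.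
    have UL : uniq [:: s; t; w; a'; b'].
      apply: uU; first by rewrite /= inE ab'.
      by move=> u; rewrite !inE => /orP[]/eqP->.
    have Na : nbl e a' [:: s; t; w] by apply: nbA; rewrite // ?Ns' ?Nt' !inE eqxx orbT.
    have fit : fits D tmpl_twins_closed 5 [:: 1] by rewrite D3.
    apply: (@engine_solved 5 tmpl_twins_closed w [:: s; t; w; a'; b'] _ KD fit UL _ check_twins_closed).
    by case=> [|[|[|[|//]]]].
  have [l [U E l1]] := listA aA bA ab.
  have [ya|ya] := eqVneq y a; first exact: (tri a b).
  have [yb|yb] := eqVneq y b.
    by apply: (tri b a) => //; rewrite 1?eq_sym //; exact: nbl_swap.
  have UL : uniq [:: s; t; w; a; b; y].
    apply: uU; first by rewrite /= !inE !negb_or ab eq_sym ya eq_sym yb.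
    by move=> u; rewrite !inE => /or3P[]/eqP->.
  have fit : fits D tmpl_twins_open 6 [:: 1; 1; 2] by rewrite D3.
  apply: (@engine_recol 5 tmpl_twins_open w [:: s; t; w; a; b; y] _ KD fit UL _ 0 check_twins_open) => //.
  by case=> [|[|[|//]]].
have sub : {subset [:: a; b; c] <= A} by move=> u; rewrite E.
have UL := uU _ U sub.
have [ya|ya] := eqVneq y a.
  rewrite ya in Nwy ewy.
  have Na : nbl e a [:: s; t; w] by apply: nbA; rewrite // ?Ns ?Nt !inE eqxx orbT.
  have fit : fits D tmpl_fork_apex 6 [:: 2; 2] by rewrite D3.
  apply: (@engine_solved 5 tmpl_fork_apex w [:: s; t; w; a; b; c] _ KD fit UL _ check_fork_apex).
  by case=> [|[|[|[|//]]]].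
have fit : fits D tmpl_fork_side 6 [:: 1; 1; 2] by rewrite D3.
have [yb|yb] := eqVneq y b.
  rewrite yb in Nwy.
  apply: (@engine_solved 5 tmpl_fork_side w [:: s; t; w; a; b; c] _ KD fit UL _ check_fork_side).
  by case=> [|[|[|//]]].
have yc : y = c by move: yA; rewrite E !inE (negbTE ya) (negbTE yb) => /eqP.
have Nwy' : nbl e w [:: t; s; c] by apply: nbl_eq Nwy => u; rewrite yc !inE orbCA.
have UL' : uniq [:: t; s; w; a; c; b].
  apply: (@uniq_config [:: t; s] [:: a; c; b]).
  - by rewrite /= inE eq_sym st.
  - by move: U; rewrite /= !inE !negb_or [c == b]eq_sym => /and3P[/andP[-> ->] ->].
  - by move=> u; rewrite SE !inE orbC.
  - by move=> u; rewrite E !inE [(u == c) || _]orbC.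
apply: (@engine_solved 5 tmpl_fork_side w [:: t; s; w; a; c; b] _ KD fit UL' _ check_fork_side).
by case=> [|[|[|//]]].
Qed.

(** Three vertices of [S] use up the degree of [w]. Either two of them are twins, or their
    neighbours in [A] are the three pairs of a 3-element set. *)
Lemma colourable_cubic : D = 3 -> colourable.
Proof.
move=> D3; case SE': (enum S) => [|s [|t [|x l]]].
- by have /set0Pn[s] := S0; rewrite -mem_enum SE'.
- have SE : S =i [:: s] by move=> u; rewrite -mem_enum SE'.
  by apply: (@colourable_single 5 [:: 1; 2; 2] [:: 1; 1] s _ check_leaf_one_common_5 _ check_leaf_two_common_5); rewrite ?D3.
- have SE : S =i [:: s; t] by move=> u; rewrite -mem_enum SE'.
  apply: (colourable_pair_cubic D3 SE).
  by have := enum_uniq S; rewrite SE' /= inE andbT.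
have SE : S =i [:: s, t, x & l] by move=> u; rewrite -mem_enum SE'.
have U : uniq [:: s, t, x & l] by rewrite -SE' enum_uniq.
have Ustx : uniq [:: s; t; x] by apply: subseq_uniq U; rewrite /= !eqxx sub0seq.
have sub : {subset [:: s; t; x] <= S} by move=> u; rewrite SE !inE => /or3P[]->; rewrite ?orbT.
have sS : s \in S by apply: sub; rewrite !inE eqxx.
have tS : t \in S by apply: sub; rewrite !inE eqxx orbT.
have xS : x \in S by apply: sub; rewrite !inE eqxx !orbT.
have Nw3 : nbl e w [:: s; t; x].
  apply: nbl_of => //; last by rewrite /= -D3.
  by rewrite /= !(se w) !eSw.
case: (pairS sS tS) => [[a [b [aA bA ab Ns Nt]]]|[a [b [c [Ua E Ns Nt]]]]].
  exact: (colourable_twins_in_triple D3 Ustx sub aA bA ab Ns Nt).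
have aA : a \in A by rewrite E !inE eqxx.
have bA : b \in A by rewrite E !inE eqxx orbT.
have cA : c \in A by rewrite E !inE eqxx !orbT.
have [ab ac] : a != b /\ a != c.
  by move: Ua; rewrite /= !inE negb_or => /andP[/andP[]].
have Usx : uniq [:: s; x; t].
  by rewrite -(perm_uniq (_ : perm_eq [:: s; t; x] _)) // perm_cons (perm_catC [:: t] [:: x]).
have Utx : uniq [:: t; x; s] by rewrite -(rot_uniq 1) in Ustx.
have twin_s : nbl e x [:: w; a; b] -> colourable.
  move=> Nx; apply: (colourable_twins_in_triple D3 Usx _ aA bA ab Ns Nx).
  by move=> u hu; apply: sub; rewrite !inE in hu *; case/or3P: hu => ->; rewrite ?orbT.
have twin_t : nbl e x [:: w; a; c] -> colourable.
  move=> Nx; apply: (colourable_twins_in_triple D3 Utx _ aA cA ac Nt Nx).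
  by move=> u hu; apply: sub; rewrite !inE in hu *; case/or3P: hu => ->; rewrite ?orbT.
have last_case : nbl e x [:: w; b; c] -> colourable.
  move=> Nx; have UL : uniq [:: s; t; x; w; a; b; c].
    by apply: (@uniq_config [:: s; t; x]) => // u; rewrite E.
  have fit : fits D tmpl_three_pairs 7 [:: 1; 1; 1] by rewrite D3.
  have KD : 5 = D + 2 by rewrite D3.
  apply: (@engine_solved 5 tmpl_three_pairs w [:: s; t; x; w; a; b; c] _ KD fit UL _ check_three_pairs).
  by case=> [|[|[|[|//]]]].
have [p [q [pA qA pq Nx]]] := nbS xS.
move: pA qA pq; rewrite !E !inE.
case/or3P=> /eqP ep /or3P[] /eqP eq; rewrite ep eq ?eqxx // => _; subst p q.
- exact: twin_s.
- exact: twin_t.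
- exact/twin_s/nbl_swap.
- exact: last_case.
- exact/twin_t/nbl_swap.
- exact/last_case/nbl_swap.
Qed.
End Configuration.
End Cases.

(** * Vertices of degree 1 and 2, and maximum degree 2 *)

Section LowDegree.
Variables (T : finType) (h e : rel T) (D : nat).
Hypotheses (se : symmetric e) (ie : irreflexive e) (eh : subrel e h).
Hypothesis degD : forall v, degree e v <= D.
Hypothesis IH : forall e' : rel T, symmetric e' -> subrel e' h -> (forall v, degree e' v <= D) ->
  #|edges e'| < #|edges e| -> exists c : T -> T -> 'I_(D + 2), tcol e' c.

Local Notation colourable := (exists c : T -> T -> 'I_(D + 2), tcol e c).

Lemma nbl_enum v : nbl e v (enum (nbhd e v)).
Proof. by move=> u; rewrite mem_enum inE. Qed.

Lemma size_nbhd v : size (enum (nbhd e v)) = degree e v.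
Proof. by rewrite -cardE. Qed.

Lemma colourable_leaf v : degree e v = 1 -> colourable.
Proof.
move=> d1; have := size_nbhd v; rewrite d1.
case E: (enum _) => [|x [|//]] // _.
have Nv : nbl e v [:: x] by rewrite -E; exact: nbl_enum.
have D1 : 0 < D by rewrite -d1.
apply: (reduce_star se ie eh degD IH (l := [:: x]) _ Nv) => //=; first by rewrite addn2 !ltnS.
by move=> y; rewrite inE => /eqP->; rewrite eqxx add0n addn2 ltnS (leq_trans (degD x)).
Qed.

Lemma colourable_degree2 v : 3 <= D -> degree e v = 2 -> colourable.
Proof.
move=> D3 d2; have := size_nbhd v; rewrite d2; have := enum_uniq (nbhd e v).
case E: (enum _) => [|x [|y [|//]]] // U _.
have Nv : nbl e v [:: x; y] by rewrite -E; exact: nbl_enum.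
apply: (reduce_star se ie eh degD IH U Nv) => //=; first by rewrite addn2 !ltnS.
move=> z zl; apply: (@leq_ltn_trans (1 + D)); last by rewrite addnC ltn_add2l.
by apply: leq_add (degD z); rewrite -index_mem in zl.
Qed.

(** Without leaves every non-isolated vertex has degree 2. The ends of one edge are recoloured, and
    their other neighbours coincide or differ. *)
Lemma colourable_cycles u w : D = 2 -> e u w -> colourable.
Proof.
move=> D2 euw; have KD : 4 = D + 2 by rewrite D2.
have [/existsP[v /eqP]|no1] := boolP [exists v, degree e v == 1]; first exact: colourable_leaf.
have deg2 v x : e v x -> degree e v = 2.
  move=> evx; have := degD v; rewrite D2 leq_eqVlt => /orP[/eqP//|].
  rewrite ltnS leq_eqVlt => /orP[d1|]; first by case/existsP: no1; exists v.
  by rewrite ltnS leqn0 cards_eq0 => /eqP/setP/(_ x); rewrite !inE evx.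
have other v x : e v x -> exists2 y, x != y & nbl e v [:: x; y].
  move=> evx; have := size_nbhd v; rewrite (deg2 v x evx); have := nbl_enum v.
  have := enum_uniq (nbhd e v); case: (enum _) => [|p [|q [|//]]] //; rewrite /= inE andbT => pq N _.
  move: (N x); rewrite evx !inE => /esym /orP[]/eqP->; first by exists q.
  by exists p; rewrite 1?eq_sym // => z; rewrite N !inE orbC.
have [x wx Nu] := other u w euw.
have ewu : e w u by rewrite se.
have [y uy Nw] := other w u ewu.
have irr v z : e v z -> v != z by move=> evz; apply: contraTneq evz => ->; rewrite ie.
have uw := irr _ _ euw.
have ux : u != x by apply: irr; rewrite Nu !inE eqxx orbT.
have wy : w != y by apply: irr; rewrite Nw !inE eqxx orbT.
have [xy|xy] := eqVneq x y.
  rewrite -xy in Nw.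
  have fit : fits D tmpl_triangle 3 [:: 0] by rewrite D2.
  have UL : uniq [:: u; w; x] by rewrite /= !inE negb_or uw ux wx.
  apply: (@engine_solved T h e D se ie eh degD IH 4 tmpl_triangle w [:: u; w; x] _ KD fit UL _ check_triangle).
  by case=> [|[|//]].
have fit : fits D tmpl_path 4 [:: 1; 1] by rewrite D2.
have UL : uniq [:: u; w; x; y] by rewrite /= !inE !negb_or uw ux uy wx wy xy.
apply: (@engine_solved T h e D se ie eh degD IH 4 tmpl_path w [:: u; w; x; y] _ KD fit UL _ check_path).
by case=> [|[|//]].
Qed.
End LowDegree.

(** * The induction on the number of edges *)

(** [e] ranges over all subgraphs of the fixed [h] with degrees at most [D], a class that also
    admits the edge added in a fork. *)
Lemma tcol_of_order (T : finType) (h : rel T) (r : T -> nat) (D : nat) (e : rel T) :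
  symmetric h -> irreflexive h -> injective r ->
  (forall v, #|[set u | h v u & r v < r u]| <= 3 /\
      {in [set u | h v u & r v < r u] &, forall x y, x != y -> h x y}) ->
  symmetric e -> subrel e h -> (forall v, degree e v <= D) ->
  exists c : T -> T -> 'I_(D + 2), tcol e c.
Proof.
move=> hs hi rI peo; have [n] := ubnP #|edges e|.
elim: n e => // n IHn e; rewrite ltnS => en se eh degD.
have IH (e' : rel T) : symmetric e' -> subrel e' h -> (forall v, degree e' v <= D) ->
    #|edges e'| < #|edges e| -> exists c : T -> T -> 'I_(D + 2), tcol e' c.
  by move=> h1 h2 h3 h4; apply: IHn => //; exact: leq_trans h4 en.
have ie : irreflexive e by move=> v; apply/negP => /eh; rewrite hi.
have [/existsP[[u v] /= euv]|no] := boolP [exists p, e p.1 p.2]; last first.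
  have no' u v : e u v = false by apply/negP => euv; case/existsP: no; exists (u, v).
  have K0 : 0 < D + 2 by rewrite addn2.
  by exists (fun _ _ => Ordinal K0); split=> [u v | u v | u v w | u v]; rewrite no'.
have D1 : 0 < D.
  by apply: leq_trans (degD u); rewrite /degree card_gt0; apply/set0Pn; exists v; rewrite inE.
have [/existsP[x /eqP]|no1] := boolP [exists v, degree e v == 1].
  exact: (colourable_leaf se ie eh degD IH).
have [D2|D2] := leqP D 2.
  have [D2'|] := eqVneq D 2; first exact: (colourable_cycles se ie eh degD IH D2' euv).
  (* If [D = 1], the end [u] of an edge is a leaf, which has been excluded. *)
  move=> D2'; case/existsP: no1; exists u; rewrite eqn_leq (leq_trans (degD u)) /=.
    by rewrite /degree card_gt0; apply/set0Pn; exists v; rewrite inE.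
  by rewrite -ltnS ltn_neqAle D2'.
have [/existsP[x /eqP]|no2] := boolP [exists v, degree e v == 2].
  exact: (colourable_degree2 se ie eh degD IH).
have deg3 x : 0 < degree e x -> 3 <= degree e x.
  case E: (degree e x) => [|[|[|k]]] // _.
    by case/existsP: no1; exists x; rewrite E.
  by case/existsP: no2; exists x; rewrite E.
have [w [A [S [[A3 Ah] [wA S0] Nw dw NS]]]] := configuration hs hi se eh rI peo euv deg3.
have [D5|D5] := leqP 5 D.
  exact: (colourable_ge5 se ie eh degD IH A3 wA S0 Nw dw NS).
have [D4|D4] := eqVneq D 4.
  exact: (colourable_quartic se ie eh hs degD IH A3 Ah wA S0 Nw dw NS).
have D3 : D = 3 by move: D2 D5 D4; clear; lia.
exact: (colourable_cubic se ie eh degD IH A3 wA S0 Nw dw NS).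
Qed.

Theorem theorem2 (T : finType) (e : rel T) :
  simple_graph e -> has_treewidth e 3 ->
  total_colourable e (max_degree e + 2).
Proof.
case=> se ie [tw _]; have [h [r [hs hi eh rI peo]]] := elimination_order ie tw.
have [|c cP] := @tcol_of_order T h r (max_degree e) e hs hi rI peo se eh.
  by move=> v; exact: leq_bigmax.
exact: total_colourable_of_tcol cP.
Qed.
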